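(* For $0<|q|<1$ we have $$F_1(q)=\frac{\widetilde\Theta_-(q)}{(q)_\infty},\qquad F_2(q)=\frac{q^{-1}\bigl(\widetilde\Theta_+(q)-1\bigr)}{(q)_\infty},\qquad F_3(q)=\frac{q^{-2}\bigl(\widetilde\Theta_-(q)-\widetilde\Theta_+(q)\bigr)}{(q)_\infty}.$$
   Context: Notation: $(q)_n=\prod_{j=1}^n(1-q^j)$, $(q)_\infty=\prod_{j\ge1}(1-q^j)$. Define $$F_1(q):=\sum_{n_1,n_2\ge0}\frac{q^{2n_1n_2+n_1+n_2}}{(q)_{n_1}(q)_{n_2}},\quad F_2(q):=\sum_{n_1,n_2\ge0}\frac{q^{2n_1n_2+n_1+2n_2}}{(q)_{n_1}(q)_{n_2}},\quad F_3(q):=\sum_{n_1,n_2\ge0}\frac{q^{2n_1n_2+2n_1+2n_2}}{(q)_{n_1}(q)_{n_2}}.$$ Let $\chi_+(n):=(-1)^{\lfloor n/30\rfloor}$ if $n^2\equiv1\pmod{120}$ and $\chi_+(n):=0$ otherwise; let $\chi_-(n):=(-1)^{\lfloor n/30\rfloor}$ if $n^2\equiv49\pmod{120}$ and $\chi_-(n):=0$ otherwise. Set $$\widetilde\Theta_+(q):=\sum_{n\ge1}\chi_+(n)q^{\frac{n^2-1}{120}},\qquad\widetilde\Theta_-(q):=\sum_{n\ge1}\chi_-(n)q^{\frac{n^2-49}{120}}.$$ *)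

(* Defs.v *)
From Stdlib Require Import Reals Lra Lia List Arith.
From Coquelicot Require Import Coquelicot.

Open Scope C_scope.

(** Unordered (equivalently, absolutely convergent) summation over
    [nat * nat]: the finite partial sums converge to [l] along the finite
    subsets of [nat * nat] directed by inclusion. *)
Definition finsum2 (a : nat -> nat -> C) (s : list (nat * nat)) : C :=
  fold_right (fun p acc => a (fst p) (snd p) + acc) 0 s.

Definition is_sum2 (a : nat -> nat -> C) (l : C) : Prop :=
  forall eps : R, (0 < eps)%R ->
    exists s0 : list (nat * nat),
      forall s : list (nat * nat),
        NoDup s -> incl s0 s -> (Cmod (finsum2 a s - l) < eps)%R.

Definition ex_sum2 (a : nat -> nat -> C) : Prop := exists l : C, is_sum2 a l.

(** [iota P] is the unique element satisfying [P], when there is one; the three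
    operators below are therefore meaningful only for convergent arguments. *)
Definition Sum2 (a : nat -> nat -> C) : C :=
  @iota C_CompleteNormedModule (is_sum2 a).

Definition CSeries (a : nat -> C) : C :=
  @iota C_CompleteNormedModule (@is_series C_AbsRing C_NormedModule a).

Fixpoint qpoch (q : C) (n : nat) : C :=
  match n with
  | O => 1
  | S m => qpoch q m * (1 - q ^ S m)
  end.

Definition is_qpoch_inf (q l : C) : Prop :=
  filterlim (qpoch q) eventually (@locally C_UniformSpace l).

Definition qpoch_inf (q : C) : C :=
  @iota C_CompleteNormedModule (is_qpoch_inf q).

Definition F1_term (q : C) (n1 n2 : nat) : C :=
  q ^ (2 * n1 * n2 + n1 + n2) / (qpoch q n1 * qpoch q n2).
Definition F2_term (q : C) (n1 n2 : nat) : C :=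
  q ^ (2 * n1 * n2 + n1 + 2 * n2) / (qpoch q n1 * qpoch q n2).
Definition F3_term (q : C) (n1 n2 : nat) : C :=
  q ^ (2 * n1 * n2 + 2 * n1 + 2 * n2) / (qpoch q n1 * qpoch q n2).

Definition F1 (q : C) : C := Sum2 (F1_term q).
Definition F2 (q : C) : C := Sum2 (F2_term q).
Definition F3 (q : C) : C := Sum2 (F3_term q).

Definition chi_plus (n : nat) : R :=
  if ((n * n) mod 120 =? 1)%nat then ((-1) ^ (n / 30)%nat)%R else 0%R.
Definition chi_minus (n : nat) : R :=
  if ((n * n) mod 120 =? 49)%nat then ((-1) ^ (n / 30)%nat)%R else 0%R.

(** The exponents use truncated subtraction and division on [nat]; they are
    exact wherever the coefficient is nonzero, see [theta_plus_exponent] and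
    [theta_minus_exponent]. *)
Definition Theta_plus_term (q : C) (n : nat) : C :=
  RtoC (chi_plus n) * q ^ ((n * n - 1) / 120).
Definition Theta_minus_term (q : C) (n : nat) : C :=
  RtoC (chi_minus n) * q ^ ((n * n - 49) / 120).

(** The sums run over [n >= 1], hence the shift. *)
Definition Theta_plus (q : C) : C := CSeries (fun k => Theta_plus_term q (S k)).
Definition Theta_minus (q : C) : C := CSeries (fun k => Theta_minus_term q (S k)).

Lemma exact_exponent (m r : nat) :
  (m mod 120 = r -> 120 * ((m - r) / 120) + r = m)%nat.
Proof.
intros H.
pose proof (Nat.div_mod_eq m 120) as E. rewrite H in E.
replace (m - r)%nat with ((m / 120) * 120)%nat by lia.
rewrite Nat.div_mul by lia. lia.
Qed.

Lemma theta_plus_exponent (n : nat) :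
  chi_plus n <> 0%R -> (120 * ((n * n - 1) / 120) + 1 = n * n)%nat.
Proof.
unfold chi_plus. destruct (Nat.eqb_spec ((n * n) mod 120) 1) as [H|H].
- intros _. exact (exact_exponent _ _ H).
- intros H0. elim H0. reflexivity.
Qed.

Lemma theta_minus_exponent (n : nat) :
  chi_minus n <> 0%R -> (120 * ((n * n - 49) / 120) + 49 = n * n)%nat.
Proof.
unfold chi_minus. destruct (Nat.eqb_spec ((n * n) mod 120) 49) as [H|H].
- intros _. exact (exact_exponent _ _ H).
- intros H0. elim H0. reflexivity.
Qed.

(* Main.v *)
Require Import Defs.
From Stdlib Require Import Reals List Lra Lia Permutation.
From Coquelicot Require Import Coquelicot.

Open Scope C_scope.

(** Write [P] for [(q)_oo].  Summing each double series over [n2] first is an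
    instance of Euler's identity [sum_m z^m / (q)_m = 1 / (z; q)_oo]
    ([euler_sum]), so that ([nahm_sum])
    [F1 P = sum_n q^n (q)_{2n} / (q)_n],
    [F2 P = sum_n q^n (q)_{2n+1} / (q)_n],
    [F3 P = sum_n q^{2n} (q)_{2n+1} / (q)_n].
    Since [(q)_{2n+2} / (q)_{n+1} = (1 + q^{n+1}) (q)_{2n+1} / (q)_n], these
    satisfy [F1 P = 1 + q F2 P + q^2 F3 P], and the third formula follows from
    the first two.  These two are identities of Rogers type for
    [sum_N q^N (q^{N+s}; q)_N] with [s = 1] and [s = 0], and are proved alike.

    Expanding [(q^{N+s}; q)_N] by the q-binomial theorem and summing over [N]
    first ([numerator_to_denominator]) gives
    [sum_n (-1)^n q^{n(n+1)/2} (q)_n beta_n] with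
    [beta_n = q^{n^2+sn} / (q)_{2n+1}].
    This [beta_n] belongs, up to a factor [1 - q], to a Bailey pair relative to
    [q]: it equals
    [sum_{r <= n} alpha_r / ((q)_{n-r} (q)_{n+r+1})], where [alpha_r] is, up to
    sign, one power of [q] or a sum of two, depending on [r] modulo 3
    ([minus_block_sum], [plus_block_sum]).  Exchanging the sums over [n] and
    [r], the inner sum
    [sum_n (-1)^n q^{n(n+1)/2} (q)_n / ((q)_{n-r} (q)_{n+r+1})
     = (-1)^r q^{r(r+1)/2}] ([conjugate_sum]) leaves the false theta series
    [sum_r (-1)^r q^{r(r+1)/2} alpha_r].  The three values of [r] with
    [r / 3 = m] give four powers of [q], which are the nonzero terms of the
    theta series with index between [30 m + 1] and [30 m + 30].

    All interchanges of summation concern double series with terms bounded by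
    [K r^n r^m] for some [r < 1], for which [cser_exchange] and
    [dominated_is_sum2] suffice. *)

(** * Convergence of complex sequences and series *)

Definition cv (u : nat -> C) (l : C) : Prop :=
  forall eps : R, (0 < eps)%R ->
    exists N : nat, forall n : nat, (N <= n)%nat -> (Cmod (u n - l) < eps)%R.

Fixpoint csum (a : nat -> C) (n : nat) : C :=
  match n with
  | O => 0
  | S m => csum a m + a m
  end.

Definition cser (a : nat -> C) (l : C) : Prop := cv (csum a) l.

Lemma filterlim_cv (u : nat -> C) (l : C) :
  filterlim u eventually (@locally C_UniformSpace l) <-> cv u l.
Proof.
split.
- intros H eps Heps.
  pose proof (proj1 (@filterlim_locally_ball_norm C_AbsRing nat C_NormedModule
    eventually _ u l) H (mkposreal eps Heps)) as [N HN].
  exists N. intros n Hn. exact (HN n Hn).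
- intros H.
  apply (proj2 (@filterlim_locally_ball_norm C_AbsRing nat C_NormedModule
    eventually _ u l)).
  intros [eps Heps]. destruct (H eps Heps) as [N HN].
  exists N. intros n Hn. exact (HN n Hn).
Qed.

Lemma cv_unique (u : nat -> C) (l l' : C) : cv u l -> cv u l' -> l = l'.
Proof.
intros H H'. apply filterlim_cv in H. apply filterlim_cv in H'.
exact (@filterlim_locally_unique nat C_AbsRing C_NormedModule eventually _
  u l l' H H').
Qed.

Lemma cv_ext (u v : nat -> C) (l : C) : (forall n, u n = v n) -> cv u l -> cv v l.
Proof.
intros E H eps Heps. destruct (H eps Heps) as [N HN].
exists N. intros n Hn. rewrite <- E. now apply HN.
Qed.

Lemma cv_const (c : C) : cv (fun _ => c) c.
Proof.
intros eps Heps. exists O. intros n _.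
replace (c - c) with (RtoC 0) by ring. now rewrite Cmod_0.
Qed.

Lemma cv_plus (u v : nat -> C) (l m : C) :
  cv u l -> cv v m -> cv (fun n => u n + v n) (l + m).
Proof.
intros Hu Hv eps Heps.
destruct (Hu (eps / 2)%R ltac:(lra)) as [N HN].
destruct (Hv (eps / 2)%R ltac:(lra)) as [M HM].
exists (N + M)%nat. intros n Hn.
specialize (HN n ltac:(lia)). specialize (HM n ltac:(lia)).
replace (u n + v n - (l + m)) with ((u n - l) + (v n - m)) by ring.
pose proof (Cmod_triangle (u n - l) (v n - m)). lra.
Qed.

Lemma cv_scal (c : C) (u : nat -> C) (l : C) :
  cv u l -> cv (fun n => c * u n) (c * l).
Proof.
intros Hu eps Heps.
pose proof (Cmod_ge_0 c) as Hc.
destruct (Hu (eps / (Cmod c + 1))%R) as [N HN].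
{ apply Rdiv_lt_0_compat; lra. }
exists N. intros n Hn. specialize (HN n Hn).
replace (c * u n - c * l) with (c * (u n - l)) by ring.
rewrite Cmod_mult.
apply Rmult_lt_compat_r with (r := (Cmod c + 1)%R) in HN; [|lra].
unfold Rdiv in HN. rewrite Rmult_assoc, Rinv_l, Rmult_1_r in HN by lra.
pose proof (Cmod_ge_0 (u n - l)). nra.
Qed.

Lemma cv_minus (u v : nat -> C) (l m : C) :
  cv u l -> cv v m -> cv (fun n => u n - v n) (l - m).
Proof.
intros Hu Hv.
replace (l - m) with (l + (-(1)) * m) by ring.
apply cv_ext with (fun n => u n + (-(1)) * v n).
{ intros n. ring. }
apply cv_plus; [exact Hu|]. now apply cv_scal.
Qed.

Lemma cv_subseq (u : nat -> C) (l : C) (f : nat -> nat) :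
  (forall n, (n <= f n)%nat) -> cv u l -> cv (fun n => u (f n)) l.
Proof.
intros Hf H eps Heps. destruct (H eps Heps) as [N HN].
exists N. intros n Hn. apply HN. specialize (Hf n). lia.
Qed.

Lemma cv_shift (u : nat -> C) (l : C) : cv (fun n => u (S n)) l <-> cv u l.
Proof.
split.
- intros H eps Heps. destruct (H eps Heps) as [N HN].
  exists (S N). intros [|n] Hn; [lia|]. apply HN. lia.
- apply (cv_subseq u l S). intros n. lia.
Qed.

Lemma cv_bound (u : nat -> C) (l c : C) (B : R) (N : nat) :
  cv u l -> (forall n, (N <= n)%nat -> Cmod (u n - c) <= B)%R ->
  (Cmod (l - c) <= B)%R.
Proof.
intros H HB. apply Rnot_lt_le. intros Hlt.
destruct (H (Cmod (l - c) - B)%R ltac:(lra)) as [M HM].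
specialize (HM (N + M)%nat ltac:(lia)).
specialize (HB (N + M)%nat ltac:(lia)).
pose proof (Cmod_triangle (u (N + M)%nat - c) (-(u (N + M)%nat - l))) as T.
rewrite Cmod_opp in T.
replace (u (N + M)%nat - c + - (u (N + M)%nat - l)) with (l - c) in T by ring.
lra.
Qed.

Lemma cv_squeeze_0 (u : nat -> C) (K r : R) :
  (0 <= r < 1)%R -> (forall n, Cmod (u n) <= K * r ^ n)%R -> cv u 0.
Proof.
intros Hr H eps Heps.
pose proof (Rabs_pos K) as HK. pose proof (Rle_abs K) as HK'.
destruct (pow_lt_1_zero r ltac:(rewrite Rabs_pos_eq; lra)
  (eps / (Rabs K + 1))%R ltac:(apply Rdiv_lt_0_compat; lra)) as [N HN].
exists N. intros n Hn. specialize (HN n Hn).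
replace (u n - 0) with (u n) by ring.
apply Rle_lt_trans with (1 := H n).
rewrite Rabs_pos_eq in HN by (apply pow_le; lra).
apply Rmult_lt_compat_r with (r := (Rabs K + 1)%R) in HN; [|lra].
unfold Rdiv in HN. rewrite Rmult_assoc, Rinv_l, Rmult_1_r in HN by lra.
pose proof (pow_le r n ltac:(lra)). nra.
Qed.

Lemma cv_close (u v : nat -> C) (l : C) (K r : R) :
  (0 <= r < 1)%R -> (forall n, Cmod (v n - u n) <= K * r ^ n)%R ->
  cv u l -> cv v l.
Proof.
intros Hr H Hu.
replace l with (l + 0) by ring.
apply cv_ext with (fun n => u n + (v n - u n)).
{ intros n. ring. }
apply cv_plus; [exact Hu|]. now apply cv_squeeze_0 with K r.
Qed.

Lemma csum_ext (a b : nat -> C) (n : nat) :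
  (forall k, (k < n)%nat -> a k = b k) -> csum a n = csum b n.
Proof.
induction n as [|n IH]; intros H; simpl; [reflexivity|].
rewrite IH, H by (intros; try apply H; lia). reflexivity.
Qed.

Lemma csum_plus (a b : nat -> C) (n : nat) :
  csum (fun k => a k + b k) n = csum a n + csum b n.
Proof. induction n as [|n IH]; simpl; [ring|]. rewrite IH. ring. Qed.

Lemma csum_scal (c : C) (a : nat -> C) (n : nat) :
  csum (fun k => c * a k) n = c * csum a n.
Proof. induction n as [|n IH]; simpl; [ring|]. rewrite IH. ring. Qed.

Lemma csum_zero (n : nat) : csum (fun _ => 0) n = 0.
Proof. induction n as [|n IH]; simpl; [reflexivity|]. rewrite IH. ring. Qed.

Lemma csum_exchange (a : nat -> nat -> C) (n m : nat) :
  csum (fun i => csum (a i) m) n = csum (fun j => csum (fun i => a i j) n) m.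
Proof.
induction n as [|n IH]; simpl.
- symmetry. apply csum_zero.
- now rewrite IH, <- csum_plus.
Qed.

Lemma csum_telescope (g : nat -> C) (n : nat) :
  csum (fun k => g (S k) - g k) n = g n - g O.
Proof. induction n as [|n IH]; simpl; [ring|]. rewrite IH. ring. Qed.

Lemma csum_shift (a : nat -> C) (n : nat) :
  csum a (S n) = a O + csum (fun k => a (S k)) n.
Proof.
induction n as [|n IH]; simpl; [ring|].
simpl in IH. rewrite IH. ring.
Qed.

Lemma csum_add (a : nat -> C) (n m : nat) :
  csum a (n + m) = csum a n + csum (fun k => a (n + k)%nat) m.
Proof.
induction m as [|m IH]; [rewrite Nat.add_0_r; simpl; ring|].
rewrite Nat.add_succ_r. simpl. rewrite IH. ring.
Qed.

Lemma csum_finite (a : nat -> C) (n m : nat) :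
  (forall k, (n <= k)%nat -> a k = 0) -> (n <= m)%nat -> csum a m = csum a n.
Proof.
intros H Hm. replace m with (n + (m - n))%nat by lia.
rewrite csum_add.
rewrite (csum_ext (fun k => a (n + k)%nat) (fun _ => 0))
  by (intros; apply H; lia).
rewrite csum_zero. ring.
Qed.

Lemma csum_block (a : nat -> C) (b n : nat) :
  csum (fun m => csum (fun i => a (b * m + i)%nat) b) n = csum a (b * n).
Proof.
induction n as [|n IH]; [now rewrite Nat.mul_0_r|].
simpl csum at 1. rewrite IH.
replace (b * S n)%nat with (b * n + b)%nat by lia.
now rewrite csum_add.
Qed.

Lemma is_series_cser (a : nat -> C) (l : C) :
  @is_series C_AbsRing C_NormedModule a l <-> cser a l.
Proof.
assert (E : forall n, @sum_n C_NormedModule a n = csum a (S n)).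
{ induction n as [|n IH].
  - rewrite sum_O. simpl. now rewrite Cplus_0_l.
  - rewrite sum_Sn, IH. reflexivity. }
unfold cser. rewrite <- cv_shift.
split; intros H.
- apply cv_ext with (2 := proj1 (filterlim_cv _ _) H). exact E.
- apply filterlim_cv. apply cv_ext with (2 := H). now intros n; rewrite E.
Qed.

Lemma cser_unique (a : nat -> C) (l l' : C) : cser a l -> cser a l' -> l = l'.
Proof. apply cv_unique. Qed.

Lemma CSeries_unique (a : nat -> C) (l : C) : cser a l -> CSeries a = l.
Proof.
intros H. refine (@iota_unique C_AbsRing C_CompleteNormedModule _ l _ _).
- intros y Hy. apply is_series_cser in Hy. now apply cser_unique with a.
- now apply is_series_cser.
Qed.

Lemma cser_ext (a b : nat -> C) (l : C) :
  (forall n, a n = b n) -> cser a l -> cser b l.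
Proof. intros E. apply cv_ext. intros n. now apply csum_ext. Qed.

Lemma cser_plus (a b : nat -> C) (l m : C) :
  cser a l -> cser b m -> cser (fun n => a n + b n) (l + m).
Proof.
intros Ha Hb. apply cv_ext with (fun n => csum a n + csum b n).
{ intros n. now rewrite csum_plus. }
now apply cv_plus.
Qed.

Lemma cser_scal (c : C) (a : nat -> C) (l : C) :
  cser a l -> cser (fun n => c * a n) (c * l).
Proof.
intros Ha. apply cv_ext with (fun n => c * csum a n).
{ intros n. now rewrite csum_scal. }
now apply cv_scal.
Qed.

Lemma cser_shift (a : nat -> C) (l : C) :
  cser (fun n => a (S n)) l <-> cser a (a O + l).
Proof.
split; intros H.
- apply cv_shift. apply cv_ext with (fun n => a O + csum (fun k => a (S k)) n).
  { intros n. now rewrite csum_shift. }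
  apply cv_plus; [apply cv_const|exact H].
- apply cv_shift in H.
  apply cv_ext with (fun n => csum a (S n) - a O).
  { intros n. rewrite csum_shift. ring. }
  replace l with (a O + l - a O) by ring.
  apply cv_minus; [exact H|apply cv_const].
Qed.

Lemma cser_finite (a : nat -> C) (n : nat) :
  (forall k, (n <= k)%nat -> a k = 0) -> cser a (csum a n).
Proof.
intros H eps Heps. exists n. intros m Hm.
rewrite (csum_finite a n m H Hm).
replace (csum a n - csum a n) with (RtoC 0) by ring. now rewrite Cmod_0.
Qed.

Lemma cser_block (a : nat -> C) (b : nat) (l : C) :
  (0 < b)%nat -> cser a l ->
  cser (fun m => csum (fun i => a (b * m + i)%nat) b) l.
Proof.
intros Hb H. apply cv_ext with (fun n => csum a (b * n)).
{ intros n. now rewrite csum_block. }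
apply cv_subseq with (2 := H). intros n. nia.
Qed.

Lemma csum_geom_bound (a : nat -> C) (K r : R) (N k : nat) :
  (0 <= r < 1)%R -> (forall n, Cmod (a n) <= K * r ^ n)%R ->
  (Cmod (csum a (N + k) - csum a N) <= K * r ^ N / (1 - r))%R.
Proof.
intros Hr H.
assert (HK : (0 <= K)%R).
{ specialize (H O). pose proof (Cmod_ge_0 (a O)). simpl in H. lra. }
assert (G : (Cmod (csum a (N + k) - csum a N)
             <= K * r ^ N / (1 - r) * (1 - r ^ k))%R).
{ induction k as [|k IH].
  - rewrite Nat.add_0_r. replace (csum a N - csum a N) with (RtoC 0) by ring.
    rewrite Cmod_0. simpl. lra.
  - rewrite Nat.add_succ_r. simpl csum.
    replace (csum a (N + k) + a (N + k)%nat - csum a N)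
      with ((csum a (N + k) - csum a N) + a (N + k)%nat) by ring.
    apply Rle_trans with (1 := Cmod_triangle _ _).
    specialize (H (N + k)%nat). rewrite pow_add in H.
    replace (K * r ^ N / (1 - r) * (1 - r ^ S k))%R
      with (K * r ^ N / (1 - r) * (1 - r ^ k) + K * (r ^ N * r ^ k))%R
      by (simpl; field; lra).
    lra. }
apply Rle_trans with (1 := G).
assert (0 <= K * r ^ N / (1 - r))%R.
{ apply Rmult_le_pos; [apply Rmult_le_pos; [exact HK|apply pow_le; lra]|].
  left. apply Rinv_0_lt_compat. lra. }
pose proof (pow_le r k ltac:(lra)). nra.
Qed.

Lemma cser_geom_tail (a : nat -> C) (l : C) (K r : R) (N : nat) :
  (0 <= r < 1)%R -> (forall n, Cmod (a n) <= K * r ^ n)%R -> cser a l ->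
  (Cmod (l - csum a N) <= K * r ^ N / (1 - r))%R.
Proof.
intros Hr H Hl. apply (cv_bound _ _ _ _ N Hl).
intros n Hn. replace n with (N + (n - N))%nat by lia.
now apply csum_geom_bound.
Qed.

Lemma cser_geom_ex (a : nat -> C) (K r : R) :
  (0 <= r < 1)%R -> (forall n, Cmod (a n) <= K * r ^ n)%R ->
  exists l, cser a l.
Proof.
intros Hr H.
destruct (@ex_series_le C_AbsRing C_CompleteNormedModule a
  (fun n => K * r ^ n)%R) as [l Hl].
- exact H.
- apply (@ex_series_scal R_AbsRing R_NormedModule K (fun n => (r ^ n)%R)).
  apply ex_series_geom. rewrite Rabs_pos_eq; lra.
- exists l. now apply is_series_cser.
Qed.

(** * Double series dominated by a geometric one *)

(** This domination is all the absolute convergence that the double series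
    below ever call for: it makes every order of summation legitimate. *)
Definition dominated (a : nat -> nat -> C) (K r : R) : Prop :=
  (0 <= r < 1)%R /\ (forall n m, Cmod (a n m) <= K * r ^ n * r ^ m)%R.

Lemma dominated_transpose (a : nat -> nat -> C) (K r : R) :
  dominated a K r -> dominated (fun m n => a n m) K r.
Proof.
intros [Hr H]. split; [exact Hr|]. intros n m. specialize (H m n). lra.
Qed.

Lemma dominated_pos (a : nat -> nat -> C) (K r : R) :
  dominated a K r -> (0 <= K)%R.
Proof.
intros [_ H]. specialize (H O O). pose proof (Cmod_ge_0 (a O O)).
simpl in H. lra.
Qed.

Lemma dominated_row_bound (a : nat -> nat -> C) (K r : R) (n : nat) (s : C) :
  dominated a K r -> cser (a n) s -> (Cmod s <= K / (1 - r) * r ^ n)%R.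
Proof.
intros [Hr H] Hs.
pose proof (cser_geom_tail (a n) s (K * r ^ n) r O Hr (H n) Hs) as T.
simpl in T. replace (s - 0) with s in T by ring.
apply Rle_trans with (1 := T). right. field. lra.
Qed.

(** The rows differ from their truncations at [N] by geometric tails, whose sum
    over the first [N] rows still tends to 0. *)
Lemma dominated_cv_box (a : nat -> nat -> C) (K r : R) (s : nat -> C) (l : C) :
  dominated a K r -> (forall n, cser (a n) (s n)) ->
  cser s l <-> cv (fun N => csum (fun n => csum (a n) N) N) l.
Proof.
intros Hd Hs. pose proof (dominated_pos _ _ _ Hd) as HK.
destruct Hd as [Hr H].
assert (D : forall N, (Cmod (csum s N - csum (fun n => csum (a n) N) N)
                       <= K / (1 - r) / (1 - r) * r ^ N)%R).
{ intros N.
  assert (E : forall k, csum s k - csum (fun n => csum (a n) N) k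
                = csum (fun n => s n - csum (a n) N) k).
  { induction k as [|k IH]; simpl; [ring|]. rewrite <- IH. ring. }
  rewrite E.
  pose proof (csum_geom_bound (fun n => s n - csum (a n) N)
    (K * r ^ N / (1 - r)) r O N Hr) as B.
  simpl in B. replace (csum (fun n => s n - csum (a n) N) N - 0)
    with (csum (fun n => s n - csum (a n) N) N) in B by ring.
  eapply Rle_trans.
  - apply B. intros n.
    eapply Rle_trans; [apply cser_geom_tail with (2 := H n); auto|].
    right. field. lra.
  - right. field. lra. }
split; intros Hl.
- eapply cv_close with (3 := Hl) (1 := Hr). intros N.
  rewrite <- Cmod_opp.
  replace (- (csum (fun n => csum (a n) N) N - csum s N))
    with (csum s N - csum (fun n => csum (a n) N) N) by ring. apply D.
- eapply cv_close with (3 := Hl) (1 := Hr). exact D.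
Qed.

(** Fubini: both iterated sums are the limit of the sums over square boxes. *)
Lemma cser_exchange (a : nat -> nat -> C) (K r : R) (s t : nat -> C) (l : C) :
  dominated a K r -> (forall n, cser (a n) (s n)) ->
  (forall m, cser (fun n => a n m) (t m)) -> cser s l -> cser t l.
Proof.
intros Hd Hs Ht Hl.
apply (dominated_cv_box (fun m n => a n m) K r t l);
  [now apply dominated_transpose|exact Ht|].
apply (dominated_cv_box a K r s l Hd Hs) in Hl.
apply cv_ext with (2 := Hl). intros N. apply csum_exchange.
Qed.

Definition box (N : nat) : list (nat * nat) := list_prod (seq 0 N) (seq 0 N).

Lemma in_box (N n m : nat) : In (n, m) (box N) <-> (n < N)%nat /\ (m < N)%nat.
Proof. unfold box. rewrite in_prod_iff, !in_seq. lia. Qed.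

Lemma NoDup_list_prod (A B : Type) (l : list A) (l' : list B) :
  NoDup l -> NoDup l' -> NoDup (list_prod l l').
Proof.
intros Hl Hl'. induction Hl as [|x l Hx Hl IH]; simpl; [constructor|].
apply NoDup_app; [|exact IH|].
- apply FinFun.Injective_map_NoDup; [|exact Hl'].
  intros y z E. now injection E.
- intros [y z] Hy Hz. apply in_map_iff in Hy. destruct Hy as [w [E _]].
  injection E as <- _. now apply in_prod_iff in Hz.
Qed.

Lemma NoDup_incl_split (s0 s : list (nat * nat)) :
  NoDup s0 -> NoDup s -> incl s0 s -> exists rest, Permutation s (s0 ++ rest).
Proof.
intros H0 Hs Hi.
assert (dec : forall x y : nat * nat, {x = y} + {x <> y})
  by (repeat decide equality).
exists (filter (fun p => if in_dec dec p s0 then false else true) s).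
apply NoDup_Permutation; [exact Hs| |].
- apply NoDup_app; [exact H0|now apply NoDup_filter|].
  intros p Hp Hf. apply filter_In in Hf. destruct Hf as [_ Hf].
  destruct (in_dec dec p s0); [discriminate|contradiction].
- intros p. rewrite in_app_iff, filter_In.
  destruct (in_dec dec p s0) as [Hp|Hp].
  + split; [now left|]. intros _. now apply Hi.
  + split; [now right|]. intros [Q|[Q _]]; [contradiction|exact Q].
Qed.

Lemma finsum2_app (a : nat -> nat -> C) (s s' : list (nat * nat)) :
  finsum2 a (s ++ s') = finsum2 a s + finsum2 a s'.
Proof.
unfold finsum2. induction s as [|p s IH]; simpl; [now rewrite Cplus_0_l|].
rewrite IH. ring.
Qed.

Lemma finsum2_perm (a : nat -> nat -> C) (s s' : list (nat * nat)) :
  Permutation s s' -> finsum2 a s = finsum2 a s'.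
Proof.
induction 1; unfold finsum2 in *; simpl.
- reflexivity.
- now f_equal.
- ring.
- congruence.
Qed.

Lemma finsum2_map (a : nat -> nat -> C) (n M : nat) :
  finsum2 a (map (fun m => (n, m)) (seq 0 M)) = csum (a n) M.
Proof.
induction M as [|M IH]; [reflexivity|].
rewrite seq_S, map_app, finsum2_app, IH. simpl. ring.
Qed.

Lemma finsum2_box (a : nat -> nat -> C) (N : nat) :
  finsum2 a (box N) = csum (fun n => csum (a n) N) N.
Proof.
unfold box.
assert (G : forall M, finsum2 a (list_prod (seq 0 M) (seq 0 N))
                      = csum (fun n => csum (a n) N) M).
{ induction M as [|M IH]; [reflexivity|].
  rewrite seq_S, Nat.add_0_l. simpl csum. rewrite <- IH, <- finsum2_map.
  generalize (seq 0 M) as l. induction l as [|x l IHl]; simpl.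
  - rewrite app_nil_r. symmetry. apply Cplus_0_l.
  - rewrite !finsum2_app, IHl. ring. }
apply G.
Qed.

Lemma finsum2_geom_box (r : R) (N : nat) :
  (r <> 1)%R ->
  finsum2 (fun n m => RtoC (r ^ n * r ^ m)) (box N)
  = RtoC (((1 - r ^ N) / (1 - r)) ^ 2).
Proof.
intros Hr.
assert (G : forall c : R, csum (fun n => RtoC (c * r ^ n)) N
                      = RtoC (c * ((1 - r ^ N) / (1 - r)))).
{ intros c. induction N as [|k IH]; simpl; [|rewrite IH, <- RtoC_plus];
  f_equal; field; lra. }
rewrite finsum2_box.
rewrite (csum_ext _ (fun n => RtoC ((1 - r ^ N) / (1 - r) * r ^ n))).
- rewrite G. f_equal. ring.
- intros n _. rewrite G. f_equal. ring.
Qed.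

Lemma finsum2_dominated (a : nat -> nat -> C) (K r : R) (s : list (nat * nat)) :
  dominated a K r ->
  (Cmod (finsum2 a s) <= K * Re (finsum2 (fun n m => RtoC (r ^ n * r ^ m)) s))%R.
Proof.
intros [_ H]. unfold finsum2. induction s as [|[n m] s IH]; simpl.
- rewrite Cmod_0. lra.
- apply Rle_trans with (1 := Cmod_triangle _ _).
  specialize (H n m). unfold Re in IH. lra.
Qed.

(** The disjoint sets [box N] and [s] lie together in some [box M], over which
    the sum is [((1 - r ^ M) / (1 - r)) ^ 2]; the difference of two such
    squares is bounded by the tail, independently of [M]. *)
Lemma finsum2_geom_tail (r : R) (N : nat) (s : list (nat * nat)) :
  (0 <= r < 1)%R -> NoDup (box N ++ s) ->
  (Re (finsum2 (fun n m => RtoC (r ^ n * r ^ m)) s)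
   <= 2 / (1 - r) ^ 2 * r ^ N)%R.
Proof.
intros Hr Hs. set (g := fun n m => RtoC (r ^ n * r ^ m)).
assert (pos : forall t, (0 <= Re (finsum2 g t))%R).
{ intros t.
  assert (Hg : dominated g 1 r).
  { split; [exact Hr|]. intros n m. unfold g. rewrite Cmod_R, Rabs_pos_eq; [lra|].
    apply Rmult_le_pos; apply pow_le; lra. }
  pose proof (finsum2_dominated g 1 r t Hg) as T. fold g in T.
  pose proof (Cmod_ge_0 (finsum2 g t)). lra. }
assert (HM : exists M, incl (box N ++ s) (box M)).
{ generalize (box N ++ s) as t. intros t.
  induction t as [|[n m] t [M IH]].
  - exists O. intros p [].
  - exists (n + m + M + 1)%nat. intros [n' m'] [E|Hp].
    + injection E as <- <-. apply in_box. lia.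
    + apply IH in Hp. apply in_box in Hp. apply in_box. lia. }
destruct HM as [M HM].
destruct (NoDup_incl_split _ (box M) Hs) as [rest HP].
{ apply NoDup_list_prod; apply seq_NoDup. }
{ exact HM. }
apply finsum2_perm with (a := g) in HP. rewrite !finsum2_app in HP.
unfold g in HP at 1 2. rewrite !finsum2_geom_box in HP by lra.
apply (f_equal Re) in HP. rewrite !re_plus in HP. simpl Re in HP.
pose proof (pos rest) as Hrest.
set (x := (/ (1 - r))%R).
assert (Hx : (0 < x)%R) by (apply Rinv_0_lt_compat; lra).
replace (2 / (1 - r) ^ 2 * r ^ N)%R with (x * x * (2 * r ^ N))%R
  by (unfold x; field; lra).
unfold Rdiv in HP. fold x in HP.
pose proof (pow_le r M ltac:(lra)) as HrM.
pose proof (pow_incr r 1 M ltac:(lra)) as HrM1. rewrite pow1 in HrM1.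
assert (Hxx : (0 < x * x)%R) by nra.
assert ((1 - r ^ M) ^ 2 - (1 - r ^ N) ^ 2 <= 2 * r ^ N)%R as HMN by nra.
apply Rmult_le_compat_l with (r := (x * x)%R) in HMN; [|lra].
unfold Re in *. lra.
Qed.

(** A finite set that contains [box N] is this box and a rest, and the sum over
    the rest is a uniformly small tail. *)
Lemma dominated_is_sum2 (a : nat -> nat -> C) (K r : R) (s : nat -> C) (l : C) :
  dominated a K r -> (forall n, cser (a n) (s n)) -> cser s l -> is_sum2 a l.
Proof.
intros Hd Hs Hl eps Heps.
apply (dominated_cv_box a K r s l Hd Hs) in Hl.
pose proof (dominated_pos _ _ _ Hd) as HK.
assert (Hr := proj1 Hd).
destruct (Hl (eps / 2)%R ltac:(lra)) as [N1 HN1].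
assert (Hz : cv (fun N => RtoC (K * (2 / (1 - r) ^ 2 * r ^ N))) 0).
{ apply cv_squeeze_0 with (K * (2 / (1 - r) ^ 2))%R r; [exact Hr|].
  intros n. rewrite Cmod_R, Rabs_pos_eq; [lra|].
  apply Rmult_le_pos; [exact HK|].
  apply Rmult_le_pos; [|apply pow_le; lra].
  apply Rmult_le_pos; [lra|]. left. apply Rinv_0_lt_compat. apply pow_lt. lra. }
destruct (Hz (eps / 2)%R ltac:(lra)) as [N2 HN2].
set (N := (N1 + N2)%nat).
specialize (HN1 N ltac:(unfold N; lia)). specialize (HN2 N ltac:(unfold N; lia)).
exists (box N). intros t Ht Hi.
assert (Hb : NoDup (box N)) by (apply NoDup_list_prod; apply seq_NoDup).
destruct (NoDup_incl_split (box N) t Hb Ht Hi) as [rest HP].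
assert (Hnd : NoDup (box N ++ rest)) by now apply Permutation_NoDup with t.
apply finsum2_perm with (a := a) in HP.
rewrite HP, finsum2_app, finsum2_box.
pose proof (finsum2_dominated a K r rest Hd) as B1.
pose proof (finsum2_geom_tail r N rest Hr Hnd) as B2.
apply Rmult_le_compat_l with (1 := HK) in B2.
replace (RtoC (K * (2 / (1 - r) ^ 2 * r ^ N)) - 0)
  with (RtoC (K * (2 / (1 - r) ^ 2 * r ^ N))) in HN2 by ring.
rewrite Cmod_R in HN2.
pose proof (Rle_abs (K * (2 / (1 - r) ^ 2 * r ^ N))).
match goal with |- (Cmod (?x + ?y - l) < _)%R =>
  replace (x + y - l) with ((x - l) + y) by ring;
  pose proof (Cmod_triangle (x - l) y) end.
lra.
Qed.

Lemma is_sum2_unique (a : nat -> nat -> C) (l l' : C) :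
  is_sum2 a l -> is_sum2 a l' -> l = l'.
Proof.
intros H H'.
assert (E : (Cmod (l - l') <= 0)%R).
{ apply Rnot_lt_le. intros Hlt.
  destruct (H (Cmod (l - l') / 2)%R ltac:(lra)) as [s0 H0].
  destruct (H' (Cmod (l - l') / 2)%R ltac:(lra)) as [s1 H1].
  assert (dec : forall x y : nat * nat, {x = y} + {x <> y})
    by (repeat decide equality).
  set (s := nodup dec (s0 ++ s1)).
  specialize (H0 s (NoDup_nodup _ _)). specialize (H1 s (NoDup_nodup _ _)).
  assert (I0 : incl s0 s).
  { intros p Hp. apply nodup_In. apply in_app_iff. now left. }
  assert (I1 : incl s1 s).
  { intros p Hp. apply nodup_In. apply in_app_iff. now right. }
  specialize (H0 I0). specialize (H1 I1).
  pose proof (Cmod_triangle (-(finsum2 a s - l)) (finsum2 a s - l')) as T.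
  rewrite Cmod_opp in T.
  replace (- (finsum2 a s - l) + (finsum2 a s - l')) with (l - l') in T by ring.
  lra. }
assert (E0 : Cmod (l - l') = 0) by (pose proof (Cmod_ge_0 (l - l')); lra).
apply Cmod_eq_0 in E0. replace l with (l - l' + l') by ring. rewrite E0. ring.
Qed.

Lemma Sum2_unique (a : nat -> nat -> C) (l : C) : is_sum2 a l -> Sum2 a = l.
Proof.
intros H. refine (@iota_unique C_AbsRing C_CompleteNormedModule _ l _ H).
intros y Hy. now apply is_sum2_unique with a.
Qed.

(** * The q-Pochhammer symbol and Euler's sum *)

Lemma pow_le_1 (r : R) (n : nat) : (0 <= r <= 1)%R -> (r ^ n <= 1)%R.
Proof. intros Hr. rewrite <- (pow1 n). now apply pow_incr. Qed.

Lemma exp_le_compat (x y : R) : (x <= y)%R -> (exp x <= exp y)%R.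
Proof.
intros [H| ->]; [left; now apply exp_increasing|apply Rle_refl].
Qed.

Lemma one_minus_pow_neq0 (q : C) (n : nat) : (Cmod q < 1)%R -> 1 - q ^ S n <> 0.
Proof.
intros Hq E.
assert (E1 : q ^ S n = 1).
{ replace (q ^ S n) with (1 - (1 - q ^ S n)) by ring. rewrite E. ring. }
apply (f_equal Cmod) in E1. rewrite Cmod_pow, Cmod_1 in E1. simpl in E1.
pose proof (Cmod_ge_0 q). pose proof (pow_le_1 (Cmod q) n ltac:(lra)).
pose proof (pow_le (Cmod q) n ltac:(lra)). nra.
Qed.

Lemma qpoch_neq0 (q : C) (n : nat) : (Cmod q < 1)%R -> qpoch q n <> 0.
Proof.
intros Hq. induction n as [|n IH]; simpl.
- intros E. apply (f_equal Re) in E. simpl in E. lra.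
- apply Cmult_neq_0; [exact IH|]. now apply one_minus_pow_neq0.
Qed.

(** Both factors [|1 - q ^ k|] and [1 / |1 - q ^ k|] are at most
    [1 + x * r ^ (k - 1) <= exp (x * r ^ (k - 1))], where [r = |q|] and
    [x = 1 / (1 - r)], and these exponents have the sum [x ^ 2]. *)
Lemma qpoch_bounded (q : C) :
  (Cmod q < 1)%R ->
  exists K : R, (1 <= K)%R /\
    forall n, (Cmod (qpoch q n) <= K)%R /\ (Cmod (/ qpoch q n) <= K)%R.
Proof.
intros Hq. pose proof (Cmod_ge_0 q) as H0.
set (r := Cmod q) in *. set (x := (/ (1 - r))%R).
assert (Hx : (x * (1 - r) = 1)%R) by (apply Rinv_l; lra).
assert (Hx0 : (0 < x)%R) by (apply Rinv_0_lt_compat; lra).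
assert (G : forall n, (Cmod (qpoch q n) <= exp (x * x * (1 - r ^ n)))%R /\
                 (Cmod (/ qpoch q n) <= exp (x * x * (1 - r ^ n)))%R).
{ induction n as [|n [IH1 IH2]].
  - simpl. rewrite Rminus_diag, Rmult_0_r, exp_0.
    replace (/ 1)%C with (RtoC 1) by (field; exact C1_nz).
    rewrite Cmod_1. lra.
  - pose proof (pow_le r n ltac:(lra)) as Hr0.
    pose proof (pow_le_1 r n ltac:(lra)) as Hr1.
    assert (Em : Cmod (q ^ S n) = (r * r ^ n)%R) by now rewrite Cmod_pow.
    replace (x * x * (1 - r ^ S n))%R
      with (x * x * (1 - r ^ n) + x * r ^ n)%R.
    2:{ replace (x * r ^ n)%R with (x * (x * (1 - r)) * r ^ n)%R
          by (rewrite Hx; ring). simpl. ring. }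
    rewrite exp_plus.
    pose proof (exp_ineq1_le (x * r ^ n)%R) as He.
    assert (Hxr : (0 <= x * r ^ n)%R) by (apply Rmult_le_pos; lra).
    assert (Hx1 : (1 <= x)%R) by nra.
    change (qpoch q (S n)) with (qpoch q n * (1 - q ^ S n)).
    split.
    + rewrite Cmod_mult. apply Rmult_le_compat; try apply Cmod_ge_0; [exact IH1|].
      apply Rle_trans with (2 := He).
      pose proof (Cmod_triangle 1 (- q ^ S n)) as T.
      rewrite Cmod_opp, Cmod_1, Em in T. unfold Cminus.
      apply Rle_trans with (1 := T). nra.
    + assert (Hn : 1 - q ^ S n <> 0) by now apply one_minus_pow_neq0.
      pose proof (qpoch_neq0 q n Hq) as Hp.
      replace (/ (qpoch q n * (1 - q ^ S n)))
        with (/ qpoch q n * / (1 - q ^ S n)) by (field; split; assumption).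
      rewrite Cmod_mult. apply Rmult_le_compat; try apply Cmod_ge_0; [exact IH2|].
      apply Rle_trans with (2 := He).
      rewrite Cmod_inv by exact Hn.
      pose proof (Cmod_triangle (1 - q ^ S n) (q ^ S n)) as T.
      replace (1 - q ^ S n + q ^ S n) with (RtoC 1) in T by ring.
      rewrite Cmod_1, Em in T.
      assert (Hlow : (0 < 1 - r * r ^ n)%R) by nra.
      apply Rle_trans with (/ (1 - r * r ^ n))%R.
      * apply Rinv_le_contravar; lra.
      * apply Rmult_le_reg_r with (1 := Hlow). rewrite Rinv_l by lra.
        replace ((1 + x * r ^ n) * (1 - r * r ^ n))%R
          with (1 + r ^ n * (x * (1 - r) - r + x * r * (1 - r ^ n)))%R by ring.
        rewrite Hx.
        assert (0 <= x * r * (1 - r ^ n))%R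
          by (repeat apply Rmult_le_pos; lra).
        nra. }
exists (exp (x * x)). split.
- rewrite <- exp_0. apply exp_le_compat. nra.
- intros n. destruct (G n) as [G1 G2].
  pose proof (pow_le r n ltac:(lra)).
  assert (exp (x * x * (1 - r ^ n)) <= exp (x * x))%R
    by (apply exp_le_compat; nra).
  lra.
Qed.

Lemma qpoch_cv (q : C) :
  (Cmod q < 1)%R -> exists P : C, cv (qpoch q) P /\ P <> 0.
Proof.
intros Hq. destruct (qpoch_bounded q Hq) as [K [HK HB]].
pose proof (Cmod_ge_0 q) as H0.
destruct (cser_geom_ex (fun k => - (qpoch q k * q ^ S k)) K (Cmod q)) as [L HL].
{ lra. }
{ intros n. rewrite Cmod_opp, Cmod_mult, Cmod_pow.
  destruct (HB n) as [B _]. pose proof (Cmod_ge_0 (qpoch q n)).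
  pose proof (pow_le (Cmod q) n ltac:(lra)). simpl.
  apply Rmult_le_compat; [lra|apply Rmult_le_pos; lra|lra|nra]. }
assert (HP : cv (qpoch q) (1 + L)).
{ apply cv_ext with (fun n => 1 + csum (fun k => - (qpoch q k * q ^ S k)) n).
  - induction n as [|n IH]; simpl; [ring|].
    simpl in IH. rewrite <- IH. ring.
  - apply cv_plus; [apply cv_const|exact HL]. }
exists (1 + L). split; [exact HP|].
intros E. rewrite E in HP.
destruct (HP (/ K)%R ltac:(apply Rinv_0_lt_compat; lra)) as [N HN].
specialize (HN N (le_n N)). destruct (HB N) as [_ B].
replace (qpoch q N - 0) with (qpoch q N) in HN by ring.
pose proof (qpoch_neq0 q N Hq) as Hn. rewrite Cmod_inv in B by exact Hn.
apply Cmod_gt_0 in Hn.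
assert (HKi : (/ K * K = 1)%R) by (apply Rinv_l; lra).
assert (Hi : (/ Cmod (qpoch q N) * Cmod (qpoch q N) = 1)%R) by (apply Rinv_l; lra).
nra.
Qed.

Lemma qpoch_inf_unique (q P : C) :
  cv (qpoch q) P -> is_qpoch_inf q P /\ qpoch_inf q = P.
Proof.
intros H. apply filterlim_cv in H. split; [exact H|].
refine (@iota_unique C_AbsRing C_CompleteNormedModule _ P _ H).
intros y Hy. apply cv_unique with (qpoch q); now apply filterlim_cv.
Qed.

Lemma qpoch_inv_cv (q P : C) :
  (Cmod q < 1)%R -> cv (qpoch q) P -> P <> 0 -> cv (fun n => / qpoch q n) (/ P).
Proof.
intros Hq HP HP0 eps Heps. destruct (qpoch_bounded q Hq) as [K [HK HB]].
assert (HPp : (0 < Cmod P)%R) by now apply Cmod_gt_0.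
destruct (HP (eps * Cmod P / K)%R) as [N HN].
{ apply Rdiv_lt_0_compat; [apply Rmult_lt_0_compat|]; lra. }
exists N. intros n Hn. specialize (HN n Hn). destruct (HB n) as [_ B].
pose proof (qpoch_neq0 q n Hq) as Hn0.
replace (/ qpoch q n - / P) with (/ qpoch q n * / P * - (qpoch q n - P))
  by (field; split; assumption).
rewrite !Cmod_mult, Cmod_opp, (Cmod_inv P) by exact HP0.
replace eps with (K * / Cmod P * (eps * Cmod P / K))%R by (field; lra).
assert (0 < / Cmod P)%R by now apply Rinv_0_lt_compat.
pose proof (Cmod_ge_0 (/ qpoch q n)). pose proof (Cmod_ge_0 (qpoch q n - P)).
apply Rle_lt_trans with (K * / Cmod P * Cmod (qpoch q n - P))%R.
- apply Rmult_le_compat_r; [lra|]. apply Rmult_le_compat_r; lra.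
- apply Rmult_lt_compat_l; [apply Rmult_lt_0_compat; lra|exact HN].
Qed.

Lemma Cmod_pow_le (q : C) (n m : nat) :
  (Cmod q < 1)%R -> (m <= n)%nat -> (Cmod (q ^ n) <= Cmod q ^ m)%R.
Proof.
intros Hq Hm. rewrite Cmod_pow. pose proof (Cmod_ge_0 q).
replace n with (m + (n - m))%nat by lia. rewrite pow_add.
pose proof (pow_le (Cmod q) m ltac:(lra)).
pose proof (pow_le_1 (Cmod q) (n - m) ltac:(lra)). nra.
Qed.

(** Euler's [sum z ^ m / (q)_m = 1 / (z; q)_oo] at [z = q ^ (b + 1)].  At
    [b = 0] the partial sums are [1 / (q)_n].  Replacing [z] by [z q] multiplies
    both sides by [1 - z]. *)
Lemma euler_sum (q P : C) (b : nat) :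
  (Cmod q < 1)%R -> cv (qpoch q) P -> P <> 0 ->
  cser (fun m => q ^ (S b * m) / qpoch q m) (qpoch q b / P).
Proof.
intros Hq HP HP0. induction b as [|b IH].
- apply cv_shift. apply cv_ext with (fun n => / qpoch q n).
  + induction n as [|n IHn].
    * simpl. field.
    * set (a := fun m => q ^ (1 * m) / qpoch q m) in *.
      change (csum a (S (S n))) with (csum a (S n) + a (S n)).
      rewrite <- IHn. unfold a. rewrite Nat.mul_1_l.
      change (qpoch q (S n)) with (qpoch q n * (1 - q ^ S n)).
      pose proof (qpoch_neq0 q n Hq). pose proof (one_minus_pow_neq0 q n Hq).
      field. split; assumption.
  + replace (qpoch q 0 / P) with (/ P) by (simpl; field; exact HP0).
    now apply qpoch_inv_cv.
- set (a := fun m => q ^ (S b * m) / qpoch q m) in IH.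
  assert (Hd : cser (fun m => a m * (1 - q ^ m)) (q ^ S b * (qpoch q b / P))).
  { replace (q ^ S b * (qpoch q b / P))
      with (a O * (1 - q ^ 0) + q ^ S b * (qpoch q b / P)) by (simpl; ring).
    apply cser_shift.
    apply cser_ext with (fun m => q ^ S b * a m).
    - intros m. unfold a. rewrite Nat.mul_succ_r, Cpow_add_r.
      change (qpoch q (S m)) with (qpoch q m * (1 - q ^ S m)).
      pose proof (qpoch_neq0 q m Hq). pose proof (one_minus_pow_neq0 q m Hq).
      field. split; assumption.
    - now apply cser_scal. }
  apply cser_ext with (fun m => a m + (-(1)) * (a m * (1 - q ^ m))).
  + intros m. unfold a.
    replace (S (S b) * m)%nat with (S b * m + m)%nat by lia.
    rewrite Cpow_add_r. pose proof (qpoch_neq0 q m Hq). field. assumption.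
  + replace (qpoch q (S b) / P)
      with (qpoch q b / P + (-(1)) * (q ^ S b * (qpoch q b / P)))
      by (simpl; field; exact HP0).
    apply cser_plus; [exact IH|]. now apply cser_scal.
Qed.

(** * The double sums as single sums *)

(** Summing over [n2] first is an instance of Euler's sum, at the exponent
    [2 n1 + b + 1]. *)
Lemma nahm_sum (q P : C) (c b : nat) (a : nat -> nat -> C) :
  (0 < Cmod q < 1)%R -> cv (qpoch q) P -> P <> 0 ->
  (forall n m, a n m = q ^ (2 * n * m + S c * n + S b * m)
                       / (qpoch q n * qpoch q m)) ->
  exists l, is_sum2 a l /\
    cser (fun n => q ^ (S c * n) * (qpoch q (2 * n + b) / qpoch q n)) (l * P).
Proof.
intros [Hq0 Hq] HP HP0 Ha. destruct (qpoch_bounded q Hq) as [K [HK HB]].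
assert (Hd : dominated a (K * K) (Cmod q)).
{ split; [lra|]. intros n m. rewrite Ha.
  replace (q ^ (2 * n * m + S c * n + S b * m) / (qpoch q n * qpoch q m))
    with (/ qpoch q n * / qpoch q m * q ^ (2 * n * m + S c * n + S b * m)).
  2:{ field. split; now apply qpoch_neq0. }
  rewrite !Cmod_mult.
  pose proof (Cmod_pow_le q (2 * n * m + S c * n + S b * m) (n + m) Hq ltac:(nia))
    as Hp.
  rewrite pow_add in Hp.
  destruct (HB n) as [_ B1]. destruct (HB m) as [_ B2].
  rewrite Rmult_assoc with (r3 := (Cmod q ^ m)%R).
  apply Rmult_le_compat; try apply Cmod_ge_0; [| |exact Hp].
  - apply Rmult_le_pos; apply Cmod_ge_0.
  - apply Rmult_le_compat; try apply Cmod_ge_0; assumption. }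
set (s := fun n => q ^ (S c * n) / qpoch q n * (qpoch q (2 * n + b) / P)).
assert (Hs : forall n, cser (a n) (s n)).
{ intros n. unfold s.
  apply cser_ext with (fun m => q ^ (S c * n) / qpoch q n
      * (q ^ (S (2 * n + b) * m) / qpoch q m)).
  - intros m. rewrite Ha.
    replace (2 * n * m + S c * n + S b * m)%nat
      with (S c * n + S (2 * n + b) * m)%nat by ring.
    rewrite Cpow_add_r. field. split; now apply qpoch_neq0.
  - apply cser_scal. now apply euler_sum. }
destruct (cser_geom_ex s (K * K / (1 - Cmod q)) (Cmod q)) as [l Hl].
{ lra. }
{ intros n. now apply dominated_row_bound with a. }
exists l. split.
- now apply dominated_is_sum2 with (K * K)%R (Cmod q) s.
- replace (l * P) with (P * l) by ring.
  apply cser_ext with (fun n => P * s n).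
  + intros n. unfold s. field. split; [now apply qpoch_neq0|exact HP0].
  + now apply cser_scal.
Qed.

(** * Reciprocal symbols and Gaussian binomials *)

(** [1 / (q)_{n-r}], with the convention [1 / (q)_k = 0] for [k < 0] that makes
    the recurrences below hold without side conditions. *)
Definition rpoch (q : C) (n r : nat) : C :=
  if (r <=? n)%nat then / qpoch q (n - r) else 0.

Lemma rpoch_gt (q : C) (n r : nat) : (n < r)%nat -> rpoch q n r = 0.
Proof.
intros H. unfold rpoch. destruct (Nat.leb_spec r n); [lia|reflexivity].
Qed.

Lemma rpoch_0_r (q : C) (n : nat) : rpoch q n 0 = / qpoch q n.
Proof. unfold rpoch. simpl. now rewrite Nat.sub_0_r. Qed.

Lemma rpoch_S_S (q : C) (n r : nat) : rpoch q (S n) (S r) = rpoch q n r.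
Proof. reflexivity. Qed.

Lemma rpoch_S_r (q : C) (n r : nat) :
  (Cmod q < 1)%R -> q ^ r * rpoch q n (S r) = (q ^ r - q ^ n) * rpoch q n r.
Proof.
intros Hq. unfold rpoch.
destruct (Nat.leb_spec (S r) n) as [H|H]; destruct (Nat.leb_spec r n) as [H'|H'];
  try lia.
- replace n with (r + S (n - S r))%nat at 2 by lia.
  replace (n - r)%nat with (S (n - S r)) by lia.
  rewrite Cpow_add_r.
  change (qpoch q (S (n - S r)))
    with (qpoch q (n - S r) * (1 - q ^ S (n - S r))).
  pose proof (qpoch_neq0 q (n - S r) Hq).
  pose proof (one_minus_pow_neq0 q (n - S r) Hq).
  field. split; assumption.
- replace r with n by lia. ring.
- ring.
Qed.

Lemma rpoch_bounded (q : C) (K : R) (n r : nat) :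
  (1 <= K)%R -> (forall k, Cmod (/ qpoch q k) <= K)%R ->
  (Cmod (rpoch q n r) <= K)%R.
Proof.
intros HK HB. unfold rpoch. destruct (r <=? n)%nat; [apply HB|].
rewrite Cmod_0. lra.
Qed.

(** The Gaussian binomial coefficient [n choose j]. *)
Definition gbinom (q : C) (n j : nat) : C := qpoch q n * rpoch q n j / qpoch q j.

Lemma gbinom_gt (q : C) (n j : nat) : (n < j)%nat -> gbinom q n j = 0.
Proof. intros H. unfold gbinom. rewrite rpoch_gt by exact H. unfold Cdiv. ring. Qed.

Lemma gbinom_0_r (q : C) (n : nat) : (Cmod q < 1)%R -> gbinom q n 0 = 1.
Proof.
intros Hq. unfold gbinom. rewrite rpoch_0_r. simpl. field. now apply qpoch_neq0.
Qed.

(** In this divided form the recurrence turns every rule of Pascal type below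
    into an identity of rational functions. *)
Lemma rpoch_S_r_div (q : C) (n r : nat) :
  q <> 0 -> (Cmod q < 1)%R -> rpoch q n (S r) = (1 - q ^ n / q ^ r) * rpoch q n r.
Proof.
intros Hq0 Hq. pose proof (Cpow_nz q r Hq0) as Hr.
replace (rpoch q n (S r)) with (q ^ r * rpoch q n (S r) / q ^ r)
  by (field; exact Hr).
rewrite rpoch_S_r by exact Hq. field. exact Hr.
Qed.

Lemma gbinom_pascal (q : C) (n j : nat) :
  q <> 0 -> (Cmod q < 1)%R ->
  gbinom q (S n) (S j) = q ^ S j * gbinom q n (S j) + gbinom q n j.
Proof.
intros Hq0 Hq. unfold gbinom. rewrite rpoch_S_S, rpoch_S_r_div by assumption.
change (qpoch q (S n)) with (qpoch q n * (1 - q ^ S n)).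
change (qpoch q (S j)) with (qpoch q j * (1 - q ^ S j)).
pose proof (qpoch_neq0 q j Hq). pose proof (one_minus_pow_neq0 q j Hq).
pose proof (Cpow_nz q j Hq0). rewrite !Cpow_S in *. field. repeat split; assumption.
Qed.

Lemma gbinom_pascal' (q : C) (n j : nat) :
  q <> 0 -> (Cmod q < 1)%R ->
  q ^ j * gbinom q (S n) (S j) = q ^ j * gbinom q n (S j) + q ^ n * gbinom q n j.
Proof.
intros Hq0 Hq. unfold gbinom. rewrite rpoch_S_S, rpoch_S_r_div by assumption.
change (qpoch q (S n)) with (qpoch q n * (1 - q ^ S n)).
change (qpoch q (S j)) with (qpoch q j * (1 - q ^ S j)).
pose proof (qpoch_neq0 q j Hq). pose proof (one_minus_pow_neq0 q j Hq).
pose proof (Cpow_nz q j Hq0). rewrite !Cpow_S in *. field. repeat split; assumption.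
Qed.

Lemma gbinom_bounded (q : C) (K : R) (n j : nat) :
  (Cmod q < 1)%R -> (1 <= K)%R ->
  (forall k, Cmod (qpoch q k) <= K /\ Cmod (/ qpoch q k) <= K)%R ->
  (Cmod (gbinom q n j) <= K * K * K)%R.
Proof.
intros Hq HK HB. unfold gbinom, Cdiv. rewrite !Cmod_mult.
pose proof (rpoch_bounded q K n j HK (fun k => proj2 (HB k))).
destruct (HB n) as [B _]. destruct (HB j) as [_ B'].
apply Rmult_le_compat; try apply Cmod_ge_0; [|apply Rmult_le_compat|]; auto;
  try apply Cmod_ge_0.
apply Rmult_le_pos; apply Cmod_ge_0.
Qed.

(** The triangular number [n (n - 1) / 2], by recursion so that no division
    enters the exponents. *)
Fixpoint tri (n : nat) : nat :=
  match n with
  | O => O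
  | S m => (tri m + m)%nat
  end.

(** The finite product [(z; q)_n]. *)
Fixpoint zprod (q z : C) (n : nat) : C :=
  match n with
  | O => 1
  | S m => zprod q z m * (1 - z * q ^ m)
  end.

Lemma zprod_qpoch (q : C) (m n : nat) :
  (Cmod q < 1)%R -> zprod q (q ^ S m) n = qpoch q (m + n) / qpoch q m.
Proof.
intros Hq. pose proof (qpoch_neq0 q m Hq) as Hm.
induction n as [|n IH].
- simpl. rewrite Nat.add_0_r. field. exact Hm.
- rewrite Nat.add_succ_r.
  change (zprod q (q ^ S m) (S n)) with (zprod q (q ^ S m) n * (1 - q ^ S m * q ^ n)).
  rewrite IH.
  change (qpoch q (S (m + n))) with (qpoch q (m + n) * (1 - q ^ S (m + n))).
  replace (S (m + n)) with (S m + n)%nat by lia. rewrite Cpow_add_r.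
  simpl. field. exact Hm.
Qed.

Lemma q_binomial_theorem (q z : C) (n N : nat) :
  q <> 0 -> (Cmod q < 1)%R -> (n < N)%nat ->
  zprod q z n = csum (fun j => (-(1)) ^ j * q ^ tri j * z ^ j * gbinom q n j) N.
Proof.
intros Hq0 Hq. revert N. induction n as [|n IH]; intros N HN.
- rewrite csum_finite with (n := 1%nat).
  + simpl. rewrite gbinom_0_r by exact Hq. ring.
  + intros k Hk. rewrite gbinom_gt by lia. ring.
  + lia.
- destruct N as [|N]; [lia|].
  assert (E : zprod q z n
    = csum (fun j => (-(1)) ^ j * q ^ tri j * z ^ j * gbinom q n j) (S N))
    by (apply IH; lia).
  change (zprod q z (S n)) with (zprod q z n * (1 - z * q ^ n)).
  replace (zprod q z n * (1 - z * q ^ n))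
    with (zprod q z n + - (z * q ^ n) * zprod q z n) by ring.
  rewrite E at 1. rewrite (IH N) by lia.
  rewrite !csum_shift, <- csum_scal.
  rewrite !gbinom_0_r by exact Hq.
  rewrite <- Cplus_assoc, <- csum_plus. f_equal.
  apply csum_ext. intros j _.
  pose proof (gbinom_pascal' q n j Hq0 Hq) as Hp.
  simpl tri. rewrite Cpow_add_r, !Cpow_S.
  replace (- (1) * (- (1)) ^ j * (q ^ tri j * q ^ j) * (z * z ^ j)
             * gbinom q (S n) (S j))
    with (- (1) * (- (1)) ^ j * q ^ tri j * (z * z ^ j)
          * (q ^ j * gbinom q (S n) (S j))) by ring.
  rewrite Hp. ring.
Qed.

(** The companion of the q-binomial theorem, [sum_n [n choose j] z ^ n
    = z ^ j / (z; q)_{j+1}], at [z = q ^ (b + 1)].  Pascal's rule makes the sums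
    [G_j] for consecutive [j] satisfy [G_{j+1} = z (q^{j+1} G_{j+1} + G_j)]. *)
Lemma gbinom_series (q : C) (b j : nat) :
  (0 < Cmod q < 1)%R ->
  cser (fun n => q ^ (S b * n) * gbinom q n j)
       (q ^ (S b * j) * qpoch q b / qpoch q (b + S j)).
Proof.
intros [Hq0 Hq].
assert (Hqz : q <> 0) by now apply Cmod_gt_0.
destruct (qpoch_bounded q Hq) as [K [HK HB]].
pose proof (qpoch_neq0 q b Hq) as Hb.
assert (ex : forall i, exists L, cser (fun n => q ^ (S b * n) * gbinom q n i) L).
{ intros i. apply cser_geom_ex with (K * K * K)%R (Cmod q); [lra|].
  intros n. rewrite Cmod_mult, Rmult_comm.
  apply Rmult_le_compat; try apply Cmod_ge_0.
  - now apply gbinom_bounded.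
  - apply Cmod_pow_le; [exact Hq|nia]. }
assert (step : forall i (g : nat -> C) l L,
  cser g l -> cser (fun n => q ^ (S b * n) * gbinom q n i) L ->
  g O - gbinom q 0 i = 0 ->
  (forall n, q ^ (S b * S n) * gbinom q (S n) i
             = q ^ S (b + i) * (q ^ (S b * n) * gbinom q n i) + g (S n)) ->
  L = l / (1 - q ^ S (b + i))).
{ intros i g l L Hg HL H0 HS.
  assert (E : L = l + q ^ S (b + i) * L).
  { apply cser_unique with (1 := HL).
    replace (l + q ^ S (b + i) * L)
      with (q ^ (S b * 0) * gbinom q 0 i + (q ^ S (b + i) * L + (l - g O))).
    2:{ rewrite Nat.mul_0_r. simpl (q ^ 0). replace (gbinom q 0 i) with (g O).
        ring. replace (gbinom q 0 i) with (g O - (g O - gbinom q 0 i)) by ring.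
        rewrite H0. ring. }
    apply (cser_shift (fun n => q ^ (S b * n) * gbinom q n i)).
    apply cser_ext with (fun n =>
      q ^ S (b + i) * (q ^ (S b * n) * gbinom q n i) + g (S n)).
    { intros n. now rewrite HS. }
    apply cser_plus; [now apply cser_scal|].
    apply cser_shift. replace (g O + (l - g O)) with l by ring. exact Hg. }
  pose proof (one_minus_pow_neq0 q (b + i) Hq) as Hn.
  replace l with (L - q ^ S (b + i) * L) by (rewrite E at 1; ring).
  field. exact Hn. }
induction j as [|j IH].
- destruct (ex O) as [L HL].
  replace (q ^ (S b * 0) * qpoch q b / qpoch q (b + 1)) with L; [exact HL|].
  rewrite (step O (fun n => if (n =? 0)%nat then 1 else 0) 1 L).
  + rewrite Nat.mul_0_r, Nat.add_0_r, Nat.add_1_r. simpl (q ^ 0).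
    change (qpoch q (S b)) with (qpoch q b * (1 - q ^ S b)).
    pose proof (one_minus_pow_neq0 q b Hq). field. split; assumption.
  + match goal with |- cser ?g _ =>
      assert (G : cser g (csum g 1));
      [|replace (csum g 1) with (RtoC 1) in G by (simpl; ring); exact G] end.
    apply cser_finite. intros [|k] Hk; [lia|reflexivity].
  + exact HL.
  + simpl. rewrite gbinom_0_r by exact Hq. ring.
  + intros n. rewrite !gbinom_0_r by exact Hq. simpl Nat.eqb. cbv iota.
    rewrite Nat.add_0_r, Nat.mul_succ_r, Cpow_add_r. ring.
- destruct (ex (S j)) as [L HL].
  replace (q ^ (S b * S j) * qpoch q b / qpoch q (b + S (S j))) with L;
    [exact HL|].
  rewrite (step (S j) (fun n => match n with
                             | O => 0
                             | S m => q ^ S b * (q ^ (S b * m) * gbinom q m j)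
                             end)
    (q ^ S b * (q ^ (S b * j) * qpoch q b / qpoch q (b + S j))) L).
  + rewrite (Nat.add_succ_r b (S j)).
    change (qpoch q (S (b + S j))) with (qpoch q (b + S j) * (1 - q ^ S (b + S j))).
    rewrite Nat.mul_succ_r, Cpow_add_r.
    pose proof (qpoch_neq0 q (b + S j) Hq).
    pose proof (one_minus_pow_neq0 q (b + S j) Hq). field. split; assumption.
  + match goal with |- cser ?g ?l => replace l with (g O + l) by ring end.
    apply cser_shift. now apply cser_scal.
  + exact HL.
  + rewrite gbinom_gt by lia. ring.
  + intros n. rewrite gbinom_pascal by assumption.
    rewrite Nat.mul_succ_r, Cpow_add_r.
    replace (S (b + S j)) with (S b + S j)%nat by lia. rewrite Cpow_add_r. ring.
Qed.

(** Expanding the product by the q-binomial theorem and summing over [N] first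
    turns each inner sum into a product, and the growing numerators [(q^N)_N]
    into denominators. *)
Lemma numerator_to_denominator (q L : C) (s : nat) :
  (0 < Cmod q < 1)%R ->
  cser (fun N => q ^ N * zprod q (q ^ (N + s)) N) L ->
  cser (fun j => (-(1)) ^ j * q ^ (tri j + s * j + S j * j)
                 * (qpoch q j / qpoch q (j + S j))) L.
Proof.
intros [Hq0 Hq] HL.
assert (Hqz : q <> 0) by now apply Cmod_gt_0.
destruct (qpoch_bounded q Hq) as [K [HK HB]].
set (a := fun N j : nat =>
  (-(1)) ^ j * q ^ (tri j + s * j) * (q ^ (S j * N) * gbinom q N j)).
apply cser_exchange with (a := a) (K := (K * K * K)%R) (r := Cmod q)
  (s := fun N => q ^ N * zprod q (q ^ (N + s)) N).
- split; [lra|]. intros N j. unfold a.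
  destruct (Nat.lt_ge_cases N j) as [HN|HN].
  + rewrite gbinom_gt by exact HN. rewrite !Cmult_0_r, Cmod_0.
    repeat apply Rmult_le_pos; try apply pow_le; lra.
  + replace ((-(1)) ^ j * q ^ (tri j + s * j) * (q ^ (S j * N) * gbinom q N j))
      with (gbinom q N j * ((-(1)) ^ j * q ^ (tri j + s * j + S j * N)))
      by (rewrite Cpow_add_r; ring).
    rewrite !Cmod_mult, Cmod_pow, Cmod_m1, pow1, Rmult_1_l, Rmult_assoc, <- pow_add.
    apply Rmult_le_compat; try apply Cmod_ge_0.
    * now apply gbinom_bounded.
    * apply Cmod_pow_le; [exact Hq|nia].
- intros N.
  replace (q ^ N * zprod q (q ^ (N + s)) N) with (csum (a N) (S N)).
  + apply cser_finite. intros j Hj. unfold a. rewrite gbinom_gt by lia. ring.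
  + rewrite (q_binomial_theorem q (q ^ (N + s)) N (S N)) by (assumption || lia).
    rewrite <- csum_scal. apply csum_ext. intros j _. unfold a.
    rewrite <- Cpow_mult_r.
    replace (S j * N)%nat with (N + N * j)%nat by lia.
    replace ((N + s) * j)%nat with (N * j + s * j)%nat by lia.
    rewrite !Cpow_add_r. ring.
- intros j. unfold a.
  replace ((-(1)) ^ j * q ^ (tri j + s * j + S j * j)
             * (qpoch q j / qpoch q (j + S j)))
    with ((-(1)) ^ j * q ^ (tri j + s * j)
          * (q ^ (S j * j) * qpoch q j / qpoch q (j + S j)))
    by (rewrite (Cpow_add_r q (tri j + s * j)); unfold Cdiv; ring).
  apply cser_scal. apply gbinom_series. lra.
- exact HL.
Qed.

(** * A pair of Bailey type with period three *)

(** [even_binom n r] is the Gaussian binomial [2n choose n-r], and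
    [odd_binom n r] is [2n+1 choose n-r]; both vanish for [r > n]. *)
Definition even_binom (q : C) (n r : nat) : C :=
  qpoch q (2 * n) * rpoch q n r / qpoch q (n + r).

Definition odd_binom (q : C) (n r : nat) : C :=
  qpoch q (S (2 * n)) * rpoch q n r / qpoch q (S (n + r)).

(** [2n+1 choose n-r+1].  For [r = 0] this is [2n+1 choose n+1], which equals
    [2n+1 choose n]. *)
Definition odd_binom_pred (q : C) (n r : nat) : C :=
  match r with
  | O => odd_binom q n 0
  | S r' => odd_binom q n r'
  end.

Lemma even_binom_gt (q : C) (n r : nat) : (n < r)%nat -> even_binom q n r = 0.
Proof. intros H. unfold even_binom. rewrite rpoch_gt by exact H. unfold Cdiv. ring. Qed.

Lemma odd_binom_gt (q : C) (n r : nat) : (n < r)%nat -> odd_binom q n r = 0.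
Proof. intros H. unfold odd_binom. rewrite rpoch_gt by exact H. unfold Cdiv. ring. Qed.

Lemma odd_binom_pascal (q : C) (n r : nat) :
  q <> 0 -> (Cmod q < 1)%R ->
  odd_binom q n r = even_binom q n r + q ^ S (n + r) * even_binom q n (S r).
Proof.
intros Hq0 Hq. unfold odd_binom, even_binom.
rewrite rpoch_S_r_div, (Nat.add_succ_r n r) by assumption.
change (qpoch q (S (2 * n))) with (qpoch q (2 * n) * (1 - q ^ S (2 * n))).
change (qpoch q (S (n + r))) with (qpoch q (n + r) * (1 - q ^ S (n + r))).
pose proof (qpoch_neq0 q (n + r) Hq). pose proof (one_minus_pow_neq0 q (n + r) Hq).
pose proof (Cpow_nz q r Hq0).
replace (2 * n)%nat with (n + n)%nat by lia.
rewrite !Cpow_S, !Cpow_add_r in *. field. repeat split; assumption.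
Qed.

Lemma odd_binom_pascal' (q : C) (n r : nat) :
  q <> 0 -> (Cmod q < 1)%R ->
  odd_binom q n r = q ^ n / q ^ r * even_binom q n r + even_binom q n (S r).
Proof.
intros Hq0 Hq. unfold odd_binom, even_binom.
rewrite rpoch_S_r_div, (Nat.add_succ_r n r) by assumption.
change (qpoch q (S (2 * n))) with (qpoch q (2 * n) * (1 - q ^ S (2 * n))).
change (qpoch q (S (n + r))) with (qpoch q (n + r) * (1 - q ^ S (n + r))).
pose proof (qpoch_neq0 q (n + r) Hq). pose proof (one_minus_pow_neq0 q (n + r) Hq).
pose proof (Cpow_nz q r Hq0).
replace (2 * n)%nat with (n + n)%nat by lia.
rewrite !Cpow_S, !Cpow_add_r in *. field. repeat split; assumption.
Qed.

Lemma qpoch_double_S (q : C) (n : nat) :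
  qpoch q (2 * S n) = qpoch q (S (2 * n)) * (1 - q ^ S n) * (1 + q ^ S n).
Proof.
replace (2 * S n)%nat with (S (S (2 * n))) by lia.
change (qpoch q (S (S (2 * n))))
  with (qpoch q (S (2 * n)) * (1 - q ^ S (S (2 * n)))).
replace (S (S (2 * n))) with (S n + S n)%nat by lia.
rewrite Cpow_add_r. ring.
Qed.

Lemma even_binom_pascal (q : C) (n r : nat) :
  q <> 0 -> (Cmod q < 1)%R ->
  even_binom q (S n) r
  = odd_binom_pred q n r + q ^ S (n + r) * odd_binom q n r.
Proof.
intros Hq0 Hq. pose proof (qpoch_double_S q n) as E2.
destruct r as [|r].
- unfold even_binom, odd_binom_pred, odd_binom. rewrite !rpoch_0_r, E2, !Nat.add_0_r.
  change (qpoch q (S n)) with (qpoch q n * (1 - q ^ S n)).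
  pose proof (qpoch_neq0 q n Hq). pose proof (one_minus_pow_neq0 q n Hq).
  field. split; assumption.
- unfold even_binom, odd_binom_pred, odd_binom.
  rewrite rpoch_S_S, rpoch_S_r_div, E2 by assumption.
  replace (S n + S r)%nat with (S (S (n + r))) by lia.
  replace (n + S r)%nat with (S (n + r)) by lia.
  change (qpoch q (S (S (n + r))))
    with (qpoch q (S (n + r)) * (1 - q ^ S (S (n + r)))).
  pose proof (qpoch_neq0 q (S (n + r)) Hq).
  pose proof (one_minus_pow_neq0 q (S (n + r)) Hq).
  pose proof (Cpow_nz q r Hq0).
  rewrite !Cpow_S, !Cpow_add_r in *. field. repeat split; assumption.
Qed.

Lemma even_binom_pascal' (q : C) (n r : nat) :
  q <> 0 -> (Cmod q < 1)%R ->
  even_binom q (S n) r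
  = q ^ S n / q ^ r * odd_binom_pred q n r + odd_binom q n r.
Proof.
intros Hq0 Hq. pose proof (qpoch_double_S q n) as E2.
destruct r as [|r].
- unfold even_binom, odd_binom_pred, odd_binom. rewrite !rpoch_0_r, E2, !Nat.add_0_r.
  change (qpoch q (S n)) with (qpoch q n * (1 - q ^ S n)).
  pose proof (qpoch_neq0 q n Hq). pose proof (one_minus_pow_neq0 q n Hq).
  simpl (q ^ 0). field. split; assumption.
- unfold even_binom, odd_binom_pred, odd_binom.
  rewrite rpoch_S_S, rpoch_S_r_div, E2 by assumption.
  replace (S n + S r)%nat with (S (S (n + r))) by lia.
  replace (n + S r)%nat with (S (n + r)) by lia.
  change (qpoch q (S (S (n + r))))
    with (qpoch q (S (n + r)) * (1 - q ^ S (S (n + r)))).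
  pose proof (qpoch_neq0 q (S (n + r)) Hq).
  pose proof (one_minus_pow_neq0 q (S (n + r)) Hq).
  pose proof (Cpow_nz q r Hq0).
  rewrite !Cpow_S, !Cpow_add_r in *. field. repeat split; assumption.
Qed.

(** The blocks of three values of [r] over which the Bailey pairs are summed.
    They come from the bilateral sum of [q^{3m^2-m} [2n choose n-3m]
    - q^{3m^2+m} [2n choose n-3m-1]] over all integers [m], and its analogues
    for [2n+1], folded by the symmetry of the binomial coefficients; the last
    term of [even_block] is taken from the next value [r = 3 (m + 1)], where
    two terms meet. *)
Definition even_block (q : C) (n m : nat) : C :=
  q ^ (3 * m * m - m) * even_binom q n (3 * m)
  - q ^ (3 * m * m + m) * even_binom q n (3 * m + 1)
  - q ^ (3 * m * m + 5 * m + 2) * even_binom q n (3 * m + 2)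
  + q ^ (3 * m * m + 7 * m + 4) * even_binom q n (3 * m + 3).

Definition minus_block (q : C) (n m : nat) : C :=
  q ^ (3 * m * m + 2 * m) * odd_binom q n (3 * m)
  - (q ^ (3 * m * m + 2 * m) + q ^ (3 * m * m + 4 * m + 1))
    * odd_binom q n (3 * m + 1)
  + q ^ (3 * m * m + 4 * m + 1) * odd_binom q n (3 * m + 2).

Definition plus_block (q : C) (n m : nat) : C :=
  q ^ (3 * m * m - m) * odd_binom q n (3 * m)
  - (q ^ (3 * m * m + m) + q ^ (3 * m * m + 5 * m + 2))
    * odd_binom q n (3 * m + 1)
  + q ^ (3 * m * m + 7 * m + 4) * odd_binom q n (3 * m + 2).

Lemma pow_pentagonal (q : C) (m : nat) :
  q <> 0 -> q ^ (3 * m * m - m) = q ^ (3 * m * m) / q ^ m.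
Proof.
intros Hq0. pose proof (Cpow_nz q m Hq0).
replace (q ^ (3 * m * m)) with (q ^ (3 * m * m - m) * q ^ m).
- field. assumption.
- rewrite <- Cpow_add_r. f_equal. nia.
Qed.

(** Powers of [q] as polynomials in [q], [q ^ n], [q ^ m] and [q ^ (3 m^2)]. *)
Ltac expand_powers Hq0 n m :=
  pose proof (Cpow_nz _ m Hq0);
  rewrite ?(pow_pentagonal _ m Hq0);
  replace (3 * m)%nat with (m + m + m)%nat by lia;
  replace (2 * m)%nat with (m + m)%nat by lia;
  replace (4 * m)%nat with (m + m + m + m)%nat by lia;
  replace (5 * m)%nat with (m + m + m + m + m)%nat by lia;
  replace (7 * m)%nat with (m + m + m + m + m + m + m)%nat by lia;
  rewrite ?Cpow_S, ?Cpow_add_r; simpl (_ ^ 0); simpl (_ ^ 1); simpl (_ ^ 2);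
  simpl (_ ^ 3); simpl (_ ^ 4).

(** The two terms of each block that the symmetry of the binomial coefficients
    exchanges are to be expanded by the two different forms of Pascal's rule.
    With this choice the unwanted terms cancel; here and in the next two lemmas
    it determines which form is used where. *)
Lemma plus_block_even (q : C) (n m : nat) :
  q <> 0 -> (Cmod q < 1)%R -> plus_block q n m = even_block q n m.
Proof.
intros Hq0 Hq. unfold plus_block, even_block.
replace (q ^ (3 * m * m - m) * odd_binom q n (3 * m)
  - (q ^ (3 * m * m + m) + q ^ (3 * m * m + 5 * m + 2)) * odd_binom q n (3 * m + 1))
  with (q ^ (3 * m * m - m) * odd_binom q n (3 * m)
  - q ^ (3 * m * m + m) * odd_binom q n (3 * m + 1)
  - q ^ (3 * m * m + 5 * m + 2) * odd_binom q n (3 * m + 1)) by ring.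
rewrite (odd_binom_pascal q n (3 * m)) by assumption.
rewrite (odd_binom_pascal q n (3 * m + 1)) at 1 by assumption.
rewrite (odd_binom_pascal' q n (3 * m + 1)) by assumption.
rewrite (odd_binom_pascal' q n (3 * m + 2)) by assumption.
replace (S (3 * m + 2)) with (3 * m + 3)%nat by lia.
replace (S (3 * m + 1)) with (3 * m + 2)%nat by lia.
replace (S (3 * m)) with (3 * m + 1)%nat by lia.
generalize (even_binom q n (3 * m)) (even_binom q n (3 * m + 1))
  (even_binom q n (3 * m + 2)) (even_binom q n (3 * m + 3)).
intros y0 y1 y2 y3. expand_powers Hq0 n m. field. split; assumption.
Qed.

Lemma minus_block_even (q : C) (n m : nat) :
  q <> 0 -> (Cmod q < 1)%R -> minus_block q n m = q ^ n * even_block q n m.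
Proof.
intros Hq0 Hq. unfold minus_block, even_block.
replace (q ^ (3 * m * m + 2 * m) * odd_binom q n (3 * m)
  - (q ^ (3 * m * m + 2 * m) + q ^ (3 * m * m + 4 * m + 1))
    * odd_binom q n (3 * m + 1))
  with (q ^ (3 * m * m + 2 * m) * odd_binom q n (3 * m)
  - q ^ (3 * m * m + 2 * m) * odd_binom q n (3 * m + 1)
  - q ^ (3 * m * m + 4 * m + 1) * odd_binom q n (3 * m + 1)) by ring.
rewrite (odd_binom_pascal' q n (3 * m)) by assumption.
rewrite (odd_binom_pascal q n (3 * m + 1)) at 1 by assumption.
rewrite (odd_binom_pascal' q n (3 * m + 1)) by assumption.
rewrite (odd_binom_pascal q n (3 * m + 2)) by assumption.
replace (S (3 * m + 2)) with (3 * m + 3)%nat by lia.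
replace (S (3 * m + 1)) with (3 * m + 2)%nat by lia.
replace (S (3 * m)) with (3 * m + 1)%nat by lia.
generalize (even_binom q n (3 * m)) (even_binom q n (3 * m + 1))
  (even_binom q n (3 * m + 2)) (even_binom q n (3 * m + 3)).
intros y0 y1 y2 y3. expand_powers Hq0 n m. field. split; assumption.
Qed.

(** What does not cancel within a block, when [even_block q (S n) m] is expanded,
    is the difference of this expression at [m] and at [m + 1]. *)
Definition block_defect (q : C) (n m : nat) : C :=
  q ^ (3 * m * m - m) * odd_binom_pred q n (3 * m)
  - q ^ (3 * m * m + m) * odd_binom q n (3 * m).

Lemma even_block_succ (q : C) (n m : nat) :
  q <> 0 -> (Cmod q < 1)%R ->
  even_block q (S n) m
  = q ^ S n * minus_block q n m + (block_defect q n m - block_defect q n (S m)).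
Proof.
intros Hq0 Hq. unfold even_block, minus_block, block_defect.
rewrite (even_binom_pascal q n (3 * m)) by assumption.
rewrite (even_binom_pascal q n (3 * m + 1)) by assumption.
rewrite (even_binom_pascal' q n (3 * m + 2)) by assumption.
rewrite (even_binom_pascal' q n (3 * m + 3)) by assumption.
replace (3 * S m)%nat with (S (3 * m + 2)) by lia.
replace (3 * m + 3)%nat with (S (3 * m + 2)) by lia.
replace (odd_binom_pred q n (3 * m + 2)) with (odd_binom q n (3 * m + 1))
  by now replace (3 * m + 2)%nat with (S (3 * m + 1)) by lia.
replace (odd_binom_pred q n (3 * m + 1)) with (odd_binom q n (3 * m))
  by now replace (3 * m + 1)%nat with (S (3 * m)) by lia.
change (odd_binom_pred q n (S (3 * m + 2))) with (odd_binom q n (3 * m + 2)).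
replace (S (3 * m + 2) * S m - S m)%nat with (3 * m * m + 5 * m + 2)%nat by nia.
replace (S (3 * m + 2) * S m + S m)%nat with (3 * m * m + 7 * m + 4)%nat by nia.
generalize (odd_binom_pred q n (3 * m)) (odd_binom q n (3 * m))
  (odd_binom q n (3 * m + 1)) (odd_binom q n (3 * m + 2))
  (odd_binom q n (S (3 * m + 2))).
intros zp z0 z1 z2 z3. expand_powers Hq0 n m. field. split; assumption.
Qed.

Lemma even_block_gt (q : C) (n m : nat) : (n < 3 * m)%nat -> even_block q n m = 0.
Proof.
intros H. unfold even_block. rewrite !even_binom_gt by lia. ring.
Qed.

(** By [minus_block_even] and [even_block_succ], passing from [n] to [n + 1]
    multiplies the sum by [q ^ n * q ^ (n + 1) = q ^ ((n + 1)^2 - n^2)]. *)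
Lemma even_block_sum (q : C) (n N : nat) :
  q <> 0 -> (Cmod q < 1)%R -> (n < N)%nat ->
  csum (even_block q n) N = q ^ (n * n).
Proof.
intros Hq0 Hq. revert N. induction n as [|n IH]; intros N HN.
- rewrite csum_finite with (n := 1%nat); [|intros; apply even_block_gt; lia|lia].
  simpl. unfold even_block. rewrite !(even_binom_gt q 0 (_ + _)) by lia.
  unfold even_binom. simpl. rewrite rpoch_0_r. simpl. field.
- rewrite (csum_ext _ (fun m => q ^ S n * q ^ n * even_block q n m
    + (-(1)) * (block_defect q n (S m) - block_defect q n m))).
  2:{ intros m _. rewrite even_block_succ, minus_block_even by assumption. ring. }
  assert (D0 : block_defect q n 0 = 0) by (unfold block_defect; simpl; ring).
  assert (DN : block_defect q n N = 0).
  { unfold block_defect. rewrite (odd_binom_gt q n (3 * N)) by lia.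
    replace (odd_binom_pred q n (3 * N)) with (RtoC 0); [ring|].
    replace (3 * N)%nat with (S (3 * N - 1)) by lia.
    symmetry. apply odd_binom_gt. lia. }
  rewrite csum_plus, !csum_scal, csum_telescope, IH, D0, DN by lia.
  replace (S n * S n)%nat with (S n + n + n * n)%nat by lia.
  rewrite !Cpow_add_r. ring.
Qed.

Lemma plus_block_sum (q : C) (n N : nat) :
  q <> 0 -> (Cmod q < 1)%R -> (n < N)%nat ->
  csum (plus_block q n) N = q ^ (n * n).
Proof.
intros Hq0 Hq HN. rewrite <- (even_block_sum q n N) by assumption.
apply csum_ext. intros m _. now apply plus_block_even.
Qed.

Lemma minus_block_sum (q : C) (n N : nat) :
  q <> 0 -> (Cmod q < 1)%R -> (n < N)%nat ->
  csum (minus_block q n) N = q ^ (n * n + n).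
Proof.
intros Hq0 Hq HN. rewrite Cpow_add_r, <- (even_block_sum q n N) by assumption.
rewrite Cmult_comm, <- csum_scal.
apply csum_ext. intros m _. now apply minus_block_even.
Qed.

(** * Passing the pair through a limiting case of Bailey's lemma *)

(** The summand of a conjugate Bailey pair: its sum over [n] is the factor by
    which the term [alpha_r] of a Bailey pair ends up multiplied. *)
Definition conjugate_term (q : C) (n r : nat) : C :=
  (-(1)) ^ n * q ^ tri (S n) * (qpoch q n * rpoch q n r / qpoch q (S (n + r))).

Lemma tri_double (n : nat) : (2 * tri (S n) = n * S n)%nat.
Proof. induction n as [|n IH]; [reflexivity|]. simpl tri in *. lia. Qed.

Lemma cser_telescope (h : nat -> C) :
  cv h 0 -> cser (fun n => h (S n) - h n) (- h O).
Proof.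
intros H. apply cv_ext with (fun n => h n - h O).
{ intros n. now rewrite csum_telescope. }
replace (- h O) with (0 - h O) by ring.
apply cv_minus; [exact H|apply cv_const].
Qed.

Lemma signed_pow_bound (q c : C) (n e k : nat) (B : R) :
  (Cmod q < 1)%R -> (k <= e)%nat -> (Cmod c <= B)%R ->
  (Cmod ((-(1)) ^ n * q ^ e * c) <= B * Cmod q ^ k)%R.
Proof.
intros Hq He Hc. rewrite !Cmod_mult, (Cmod_pow (-(1))), Cmod_m1, pow1, Rmult_1_l.
rewrite Rmult_comm. apply Rmult_le_compat; try apply Cmod_ge_0; [exact Hc|].
now apply Cmod_pow_le.
Qed.

Lemma conjugate_coeff_bounded (q : C) (K : R) (n r k : nat) :
  (1 <= K)%R -> (forall k, Cmod (qpoch q k) <= K /\ Cmod (/ qpoch q k) <= K)%R ->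
  (Cmod (qpoch q n * rpoch q n r / qpoch q k) <= K * K * K)%R.
Proof.
intros HK HB. unfold Cdiv. rewrite !Cmod_mult.
pose proof (rpoch_bounded q K n r HK (fun i => proj2 (HB i))).
destruct (HB n) as [B _]. destruct (HB k) as [_ B'].
apply Rmult_le_compat; try apply Cmod_ge_0; [|apply Rmult_le_compat|]; auto;
  try apply Cmod_ge_0.
apply Rmult_le_pos; apply Cmod_ge_0.
Qed.

(** The right-hand side [c_r] satisfies [c_{r+1} + q^{r+1} c_r = 0], and the same
    combination of the terms is a difference in [n] of the sequence
    [h n = - (1 + q^{r+1}) (1 - q^{n-r}) conjugate_term q n r], which vanishes at 0
    and at infinity.  At [r = 0] the terms themselves telescope. *)
Lemma conjugate_sum (q : C) (r : nat) :
  (0 < Cmod q < 1)%R ->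
  cser (fun n => conjugate_term q n r) ((-(1)) ^ r * q ^ tri (S r)).
Proof.
intros [Hq0 Hq].
assert (Hqz : q <> 0) by now apply Cmod_gt_0.
destruct (qpoch_bounded q Hq) as [K [HK HB]].
induction r as [|r IH].
- set (h := fun n => - ((-(1)) ^ n * q ^ tri (S n) * / qpoch q n)).
  replace ((-(1)) ^ 0 * q ^ tri 1) with (- h O) by (unfold h; simpl; field).
  apply cser_ext with (fun n => h (S n) - h n).
  + intros n. unfold h, conjugate_term. rewrite rpoch_0_r, Nat.add_0_r.
    change (tri (S (S n))) with (tri (S n) + S n)%nat.
    change (qpoch q (S n)) with (qpoch q n * (1 - q ^ S n)).
    rewrite (Cpow_add_r q (tri (S n))), (Cpow_S (-(1))).
    pose proof (qpoch_neq0 q n Hq). pose proof (one_minus_pow_neq0 q n Hq).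
    field. split; assumption.
  + apply cser_telescope. apply cv_squeeze_0 with K (Cmod q); [lra|].
    intros n. unfold h. rewrite Cmod_opp.
    apply signed_pow_bound; [exact Hq| |apply HB].
    pose proof (tri_double n). nia.
- set (h := fun n => - ((1 + q ^ S r) * ((-(1)) ^ n * q ^ tri (S n)
        * (qpoch q n * rpoch q n (S r) / qpoch q (S (n + r)))))).
  assert (Hh : cser (fun n => h (S n) - h n) (- h O)).
  { apply cser_telescope.
    apply cv_squeeze_0 with (Cmod (1 + q ^ S r) * (K * K * K))%R (Cmod q); [lra|].
    intros n. unfold h. rewrite Cmod_opp, Cmod_mult, Rmult_assoc.
    apply Rmult_le_compat_l; [apply Cmod_ge_0|].
    apply signed_pow_bound; [exact Hq| |].
    - pose proof (tri_double n). nia.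
    - now apply conjugate_coeff_bounded. }
  replace (- h O) with (RtoC 0) in Hh
    by (unfold h; rewrite rpoch_gt by lia; unfold Cdiv; ring).
  apply cser_ext with (fun n => (h (S n) - h n) + - q ^ S r * conjugate_term q n r).
  + intros n. unfold h, conjugate_term. rewrite rpoch_S_S, rpoch_S_r_div by assumption.
    replace (n + S r)%nat with (S (n + r)) by lia.
    change (S n + r)%nat with (S (n + r)).
    change (tri (S (S n))) with (tri (S n) + S n)%nat.
    change (qpoch q (S (S (n + r))))
      with (qpoch q (S (n + r)) * (1 - q ^ S (S (n + r)))).
    change (qpoch q (S n)) with (qpoch q n * (1 - q ^ S n)).
    pose proof (qpoch_neq0 q (S (n + r)) Hq).
    pose proof (one_minus_pow_neq0 q (S (n + r)) Hq).
    pose proof (Cpow_nz q r Hqz).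
    rewrite (Cpow_add_r q (tri (S n))), (Cpow_S (-(1))).
    rewrite !Cpow_S, !Cpow_add_r in *. field. repeat split; assumption.
  + replace ((-(1)) ^ S r * q ^ tri (S (S r)))
      with (0 + - q ^ S r * ((-(1)) ^ r * q ^ tri (S r))).
    * apply cser_plus; [exact Hh|]. now apply cser_scal.
    * change (tri (S (S r))) with (tri (S r) + S r)%nat.
      rewrite Cpow_add_r, (Cpow_S (-(1))). ring.
Qed.

(** Bailey's lemma, with one parameter [q] and the other sent to infinity, for
    a sequence [alpha] given in blocks of three: divide the hypothesis on [B] by
    [(q)_{2n+1}], sum against the weights, and exchange. *)
Lemma bailey_limit (q L : C) (w0 w1 w2 B : nat -> C) :
  (0 < Cmod q < 1)%R ->
  (forall m, Cmod (w0 m) <= 2 /\ Cmod (w1 m) <= 2 /\ Cmod (w2 m) <= 2)%R ->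
  (forall n, csum (fun m => w0 m * odd_binom q n (3 * m)
                     + w1 m * odd_binom q n (3 * m + 1)
                     + w2 m * odd_binom q n (3 * m + 2)) (S n) = B n) ->
  cser (fun n => (-(1)) ^ n * q ^ tri (S n)
                 * (qpoch q n / qpoch q (S (2 * n)) * B n)) L ->
  cser (fun m => w0 m * ((-(1)) ^ (3 * m) * q ^ tri (S (3 * m)))
               + w1 m * ((-(1)) ^ (3 * m + 1) * q ^ tri (S (3 * m + 1)))
               + w2 m * ((-(1)) ^ (3 * m + 2) * q ^ tri (S (3 * m + 2)))) L.
Proof.
intros [Hq0 Hq] Hw HB HL.
destruct (qpoch_bounded q Hq) as [K [HK HP]].
set (a := fun n m => w0 m * conjugate_term q n (3 * m)
                   + w1 m * conjugate_term q n (3 * m + 1)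
                   + w2 m * conjugate_term q n (3 * m + 2)).
assert (Hz : forall n m, (n < m)%nat -> a n m = 0).
{ intros n m Hm. unfold a, conjugate_term. rewrite !rpoch_gt by lia.
  unfold Cdiv. ring. }
eapply cser_exchange with (a := a) (K := (6 * (K * K * K) * / Cmod q)%R)
  (r := Cmod q); [| |  |exact HL].
- split; [lra|]. intros n m.
  destruct (Nat.lt_ge_cases n m) as [Hm|Hm].
  + rewrite Hz by exact Hm. rewrite Cmod_0.
    assert (0 < / Cmod q)%R by now apply Rinv_0_lt_compat.
    repeat apply Rmult_le_pos; try apply pow_le; lra.
  + destruct (Hw m) as [H0 [H1 H2]].
    assert (Hc : forall r, (Cmod (conjugate_term q n r)
                    <= K * K * K * / Cmod q * (Cmod q ^ n * Cmod q ^ m))%R).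
    { intros r. rewrite <- pow_add.
      apply Rle_trans with (K * K * K * / Cmod q * (Cmod q ^ S (tri (S n))))%R.
      - rewrite <- tech_pow_Rmult.
        replace (K * K * K * / Cmod q * (Cmod q * Cmod q ^ tri (S n)))%R
          with (K * K * K * Cmod q ^ tri (S n))%R by (field; lra).
        apply signed_pow_bound; [exact Hq|lia|]. now apply conjugate_coeff_bounded.
      - apply Rmult_le_compat_l.
        + assert (0 < / Cmod q)%R by now apply Rinv_0_lt_compat.
          repeat apply Rmult_le_pos; lra.
        + rewrite <- Cmod_pow. apply Cmod_pow_le; [exact Hq|].
          (* [n + m <= 2 n <= n (n + 1) / 2 + 1], as [(n - 1) (n - 2) >= 0] *)
          pose proof (tri_double n). destruct n as [|[|n]]; nia. }
    assert (Ht : forall w r, (Cmod w <= 2)%R -> (Cmod (w * conjugate_term q n r)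
              <= 2 * (K * K * K * / Cmod q * (Cmod q ^ n * Cmod q ^ m)))%R).
    { intros w r Hwr. rewrite Cmod_mult.
      apply Rmult_le_compat; try apply Cmod_ge_0; [exact Hwr|apply Hc]. }
    unfold a.
    eapply Rle_trans; [apply Cmod_triangle|].
    pose proof (Cmod_triangle (w0 m * conjugate_term q n (3 * m))
                              (w1 m * conjugate_term q n (3 * m + 1))).
    pose proof (Ht _ (3 * m)%nat H0). pose proof (Ht _ (3 * m + 1)%nat H1).
    pose proof (Ht _ (3 * m + 2)%nat H2). lra.
- intros n. cbv beta. rewrite <- HB.
  replace ((-(1)) ^ n * q ^ tri (S n) * (qpoch q n / qpoch q (S (2 * n)) *
     csum (fun m => w0 m * odd_binom q n (3 * m)
       + w1 m * odd_binom q n (3 * m + 1) + w2 m * odd_binom q n (3 * m + 2)) (S n)))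
    with (csum (a n) (S n)).
  + apply cser_finite. intros m Hm. apply Hz. lia.
  + rewrite <- !csum_scal. apply csum_ext. intros m _.
    unfold a, conjugate_term, odd_binom.
    field. repeat split; now apply qpoch_neq0.
- intros m. unfold a. repeat apply cser_plus; apply cser_scal; apply conjugate_sum; lra.
Qed.

(** * The false theta functions *)

(** Modulo 120, [(30 m + i)^2] is [60 m^2 + 60 m i + i^2], which depends on [m]
    only through its parity. *)
Lemma square_mod_120 (m i : nat) :
  ((30 * m + i) * (30 * m + i) mod 120
   = (if Nat.even m then i * i else (30 + i) * (30 + i)) mod 120)%nat.
Proof.
destruct (Nat.Even_or_Odd m) as [[k ->]|[k ->]].
- rewrite Nat.even_even.
  replace ((30 * (2 * k) + i) * (30 * (2 * k) + i))%nat
    with (i * i + (30 * k * k + k * i) * 120)%nat by ring.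
  apply Nat.Div0.mod_add.
- rewrite Nat.even_odd.
  replace ((30 * (2 * k + 1) + i) * (30 * (2 * k + 1) + i))%nat
    with ((30 + i) * (30 + i) + (30 * k * k + k * (30 + i)) * 120)%nat by ring.
  apply Nat.Div0.mod_add.
Qed.

Lemma chi_plus_block (m i : nat) :
  (i < 30)%nat ->
  chi_plus (S (30 * m + i))
  = if existsb (Nat.eqb i) (0 :: 10 :: 18 :: 28 :: nil)%nat then ((-1) ^ m)%R else 0%R.
Proof.
intros Hi. unfold chi_plus.
replace (S (30 * m + i)) with (30 * m + S i)%nat by lia.
rewrite square_mod_120.
replace (30 * m + S i)%nat with (S i + m * 30)%nat by lia.
rewrite Nat.div_add by lia.
destruct (Nat.even m);
  do 30 (destruct i as [|i]; [reflexivity|]); lia.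
Qed.

Lemma chi_minus_block (m i : nat) :
  (i < 30)%nat ->
  chi_minus (S (30 * m + i))
  = if existsb (Nat.eqb i) (6 :: 12 :: 16 :: 22 :: nil)%nat then ((-1) ^ m)%R else 0%R.
Proof.
intros Hi. unfold chi_minus.
replace (S (30 * m + i)) with (30 * m + S i)%nat by lia.
rewrite square_mod_120.
replace (30 * m + S i)%nat with (S i + m * 30)%nat by lia.
rewrite Nat.div_add by lia.
destruct (Nat.even m);
  do 30 (destruct i as [|i]; [reflexivity|]); lia.
Qed.

Lemma theta_exponent (n e c : nat) :
  (n * n = 120 * e + c)%nat -> ((n * n - c) / 120 = e)%nat.
Proof.
intros ->. replace (120 * e + c - c)%nat with (e * 120)%nat by lia.
now apply Nat.div_mul.
Qed.

Lemma RtoC_sign (m : nat) : RtoC ((-1) ^ m) = (-(1)) ^ m.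
Proof. now rewrite RtoC_pow, <- RtoC_opp. Qed.

Lemma sign_triple (m : nat) : (-(1)) ^ (3 * m) = (-(1)) ^ m.
Proof.
replace (3 * m)%nat with (2 * m + m)%nat by lia.
rewrite Cpow_add_r, Cpow_mult_r.
replace ((-(1)) ^ 2) with (RtoC 1) by (simpl; ring).
rewrite Cpow_1_l. ring.
Qed.

(** In each block of 30 consecutive indices, [chi_plus] is nonzero exactly at
    the residues 1, 11, 19, 29. *)
Lemma Theta_plus_block (q : C) (m : nat) :
  q <> 0 ->
  csum (fun i => Theta_plus_term q (S (30 * m + i))) 30
  = q ^ (3 * m * m - m) * ((-(1)) ^ (3 * m) * q ^ tri (S (3 * m)))
    + - (q ^ (3 * m * m + m) + q ^ (3 * m * m + 5 * m + 2))
      * ((-(1)) ^ (3 * m + 1) * q ^ tri (S (3 * m + 1)))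
    + q ^ (3 * m * m + 7 * m + 4) * ((-(1)) ^ (3 * m + 2) * q ^ tri (S (3 * m + 2))).
Proof.
intros Hq0.
set (e := fun i => ((S (30 * m + i) * S (30 * m + i) - 1) / 120)%nat).
rewrite (csum_ext _ (fun i =>
  (if existsb (Nat.eqb i) (0 :: 10 :: 18 :: 28 :: nil)%nat then (-(1)) ^ m else 0)
  * q ^ e i)).
2:{ intros i Hi. unfold Theta_plus_term. rewrite chi_plus_block by exact Hi.
    fold (e i). f_equal. destruct (existsb _ _); [apply RtoC_sign|reflexivity]. }
pose proof (tri_double (3 * m)) as T0. pose proof (tri_double (3 * m + 1)) as T1.
pose proof (tri_double (3 * m + 2)) as T2.
assert (E0 : e 0%nat = (3 * m * m - m + tri (S (3 * m)))%nat)
  by (apply theta_exponent; nia).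
assert (E1 : e 10%nat = (3 * m * m + m + tri (S (3 * m + 1)))%nat)
  by (apply theta_exponent; nia).
assert (E2 : e 18%nat = (3 * m * m + 5 * m + 2 + tri (S (3 * m + 1)))%nat)
  by (apply theta_exponent; nia).
assert (E3 : e 28%nat = (3 * m * m + 7 * m + 4 + tri (S (3 * m + 2)))%nat)
  by (apply theta_exponent; nia).
clearbody e. cbn [csum existsb Nat.eqb orb]. rewrite E0, E1, E2, E3.
rewrite !(Cpow_add_r (-(1))), sign_triple.
rewrite (Cpow_add_r q (3 * m * m - m)), (Cpow_add_r q (3 * m * m + m)),
  (Cpow_add_r q (3 * m * m + 5 * m + 2)), (Cpow_add_r q (3 * m * m + 7 * m + 4)).
simpl ((-(1)) ^ 1). simpl ((-(1)) ^ 2). ring.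
Qed.

(** As above, with the residues 7, 13, 17, 23. *)
Lemma Theta_minus_block (q : C) (m : nat) :
  csum (fun i => Theta_minus_term q (S (30 * m + i))) 30
  = q ^ (3 * m * m + 2 * m) * ((-(1)) ^ (3 * m) * q ^ tri (S (3 * m)))
    + - (q ^ (3 * m * m + 2 * m) + q ^ (3 * m * m + 4 * m + 1))
      * ((-(1)) ^ (3 * m + 1) * q ^ tri (S (3 * m + 1)))
    + q ^ (3 * m * m + 4 * m + 1) * ((-(1)) ^ (3 * m + 2) * q ^ tri (S (3 * m + 2))).
Proof.
set (e := fun i => ((S (30 * m + i) * S (30 * m + i) - 49) / 120)%nat).
rewrite (csum_ext _ (fun i =>
  (if existsb (Nat.eqb i) (6 :: 12 :: 16 :: 22 :: nil)%nat then (-(1)) ^ m else 0)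
  * q ^ e i)).
2:{ intros i Hi. unfold Theta_minus_term. rewrite chi_minus_block by exact Hi.
    fold (e i). f_equal. destruct (existsb _ _); [apply RtoC_sign|reflexivity]. }
pose proof (tri_double (3 * m)) as T0. pose proof (tri_double (3 * m + 1)) as T1.
pose proof (tri_double (3 * m + 2)) as T2.
assert (E0 : e 6%nat = (3 * m * m + 2 * m + tri (S (3 * m)))%nat)
  by (apply theta_exponent; nia).
assert (E1 : e 12%nat = (3 * m * m + 2 * m + tri (S (3 * m + 1)))%nat)
  by (apply theta_exponent; nia).
assert (E2 : e 16%nat = (3 * m * m + 4 * m + 1 + tri (S (3 * m + 1)))%nat)
  by (apply theta_exponent; nia).
assert (E3 : e 22%nat = (3 * m * m + 4 * m + 1 + tri (S (3 * m + 2)))%nat)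
  by (apply theta_exponent; nia).
clearbody e. cbn [csum existsb Nat.eqb orb]. rewrite E0, E1, E2, E3.
rewrite !(Cpow_add_r (-(1))), sign_triple.
rewrite !(Cpow_add_r q (3 * m * m + 2 * m)), !(Cpow_add_r q (3 * m * m + 4 * m + 1)).
simpl ((-(1)) ^ 1). simpl ((-(1)) ^ 2). ring.
Qed.

Lemma theta_ex (q : C) (x : nat -> R) (c : nat) :
  (0 < Cmod q < 1)%R -> (c <= 49)%nat -> (forall n, Rabs (x n) <= 1)%R ->
  exists l, cser (fun k => RtoC (x (S k)) * q ^ ((S k * S k - c) / 120)) l.
Proof.
intros [Hq0 Hq] Hc Hx.
(* [(n^2 - 49) / 120 >= n - 31] as [(n - 60)^2 >= 0] *)
apply cser_geom_ex with (/ Cmod q ^ 60)%R (Cmod q); [lra|].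
intros k. set (e := ((S k * S k - c) / 120)%nat).
assert (He : (k <= 60 + e)%nat).
{ pose proof (Nat.div_mod_eq (S k * S k - c) 120) as D.
  pose proof (Nat.mod_upper_bound (S k * S k - c) 120 ltac:(lia)).
  fold e in D. destruct (Nat.le_gt_cases k 60); [lia|]. nia. }
pose proof (Cmod_pow_le q (60 + e) k Hq He) as B.
rewrite Cpow_add_r, Cmod_mult, Cmod_pow in B.
assert (Hp : (0 < Cmod q ^ 60)%R) by now apply pow_lt.
rewrite Cmod_mult, Cmod_R.
apply Rle_trans with (Cmod (q ^ e)).
- pose proof (Cmod_ge_0 (q ^ e)). specialize (Hx (S k)). nra.
- apply Rmult_le_reg_l with (1 := Hp).
  rewrite <- Rmult_assoc, Rinv_r, Rmult_1_l by lra. exact B.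
Qed.

Lemma chi_bounded (n : nat) : (Rabs (chi_plus n) <= 1 /\ Rabs (chi_minus n) <= 1)%R.
Proof.
assert (H0 : (Rabs 0 <= 1)%R) by (rewrite Rabs_R0; lra).
unfold chi_plus, chi_minus. split; destruct (_ =? _)%nat; try exact H0;
  rewrite pow_1_abs; lra.
Qed.

Lemma Cmod_opp_plus_le (a b : C) (A B : R) :
  (Cmod a <= A)%R -> (Cmod b <= B)%R -> (Cmod (- (a + b)) <= A + B)%R.
Proof.
intros. rewrite Cmod_opp. apply Rle_trans with (1 := Cmod_triangle a b). lra.
Qed.

Lemma false_theta_minus (q L : C) :
  (0 < Cmod q < 1)%R ->
  cser (fun N => q ^ N * (qpoch q (2 * N) / qpoch q N)) L ->
  cser (fun k => Theta_minus_term q (S k)) L.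
Proof.
intros Hq HL. assert (Hq0 : q <> 0) by now apply Cmod_gt_0.
assert (Hq1 := proj2 Hq).
assert (HL' : cser (fun N => q ^ N * zprod q (q ^ (N + 1)) N) L).
{ apply cser_ext with (2 := HL). intros N.
  rewrite Nat.add_1_r, zprod_qpoch by exact Hq1.
  now replace (N + N)%nat with (2 * N)%nat by lia. }
apply (numerator_to_denominator q L 1 Hq) in HL'.
destruct (theta_ex q chi_minus 49 Hq ltac:(lia) (fun n => proj2 (chi_bounded n)))
  as [T HT].
change (cser (fun k => Theta_minus_term q (S k)) T) in HT.
replace L with T; [exact HT|].
apply (cser_block _ 30) in HT; [|lia].
apply cser_unique with (1 := HT).
assert (P : forall e, (Cmod (q ^ e) <= 1)%R)
  by (intros e; apply (Cmod_pow_le q e 0); [exact Hq1|lia]).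
eapply cser_ext; [|apply (bailey_limit q L
  (fun m => q ^ (3 * m * m + 2 * m))
  (fun m => - (q ^ (3 * m * m + 2 * m) + q ^ (3 * m * m + 4 * m + 1)))
  (fun m => q ^ (3 * m * m + 4 * m + 1))
  (fun n => q ^ (n * n + n)) Hq)].
- intros m. symmetry. apply Theta_minus_block.
- intros m. cbv beta.
  pose proof (P (3 * m * m + 2 * m)%nat). pose proof (P (3 * m * m + 4 * m + 1)%nat).
  split; [lra|]. split; [|lra].
  replace 2%R with (1 + 1)%R by ring. now apply Cmod_opp_plus_le.
- intros n. rewrite <- (minus_block_sum q n (S n)) by (assumption || lia).
  apply csum_ext. intros m _. unfold minus_block. ring.
- apply cser_ext with (2 := HL'). intros n.
  replace (n + S n)%nat with (S (2 * n)) by lia.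
  replace (tri n + 1 * n + S n * n)%nat with (tri (S n) + (n * n + n))%nat
    by (simpl; lia).
  rewrite Cpow_add_r. unfold Cdiv. ring.
Qed.

(** The term [N = 0] of [sum_N q^N (q^N; q)_N] is 1, and the others are those of
    the hypothesis, shifted by one. *)
Lemma false_theta_plus (q L : C) :
  (0 < Cmod q < 1)%R ->
  cser (fun N => q ^ N * (qpoch q (2 * N + 1) / qpoch q N)) L ->
  cser (fun k => Theta_plus_term q (S k)) (1 + q * L).
Proof.
intros Hq HL. assert (Hq0 : q <> 0) by now apply Cmod_gt_0.
assert (Hq1 := proj2 Hq).
assert (HL' : cser (fun N => q ^ N * zprod q (q ^ (N + 0)) N) (1 + q * L)).
{ replace (1 + q * L) with (q ^ 0 * zprod q (q ^ (0 + 0)) 0 + q * L)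
    by (simpl; ring).
  apply (cser_shift (fun N => q ^ N * zprod q (q ^ (N + 0)) N)).
  apply (cser_scal q) in HL.
  apply cser_ext with (2 := HL). intros N.
  rewrite Nat.add_0_r, zprod_qpoch by exact Hq1.
  replace (N + S N)%nat with (2 * N + 1)%nat by lia. rewrite Cpow_S. ring. }
apply (numerator_to_denominator q _ 0 Hq) in HL'.
destruct (theta_ex q chi_plus 1 Hq ltac:(lia) (fun n => proj1 (chi_bounded n)))
  as [T HT].
change (cser (fun k => Theta_plus_term q (S k)) T) in HT.
replace (1 + q * L) with T; [exact HT|].
apply (cser_block _ 30) in HT; [|lia].
apply cser_unique with (1 := HT).
assert (P : forall e, (Cmod (q ^ e) <= 1)%R)
  by (intros e; apply (Cmod_pow_le q e 0); [exact Hq1|lia]).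
eapply cser_ext; [|apply (bailey_limit q (1 + q * L)
  (fun m => q ^ (3 * m * m - m))
  (fun m => - (q ^ (3 * m * m + m) + q ^ (3 * m * m + 5 * m + 2)))
  (fun m => q ^ (3 * m * m + 7 * m + 4))
  (fun n => q ^ (n * n)) Hq)].
- intros m. symmetry. now apply Theta_plus_block.
- intros m. cbv beta.
  pose proof (P (3 * m * m - m)%nat). pose proof (P (3 * m * m + 7 * m + 4)%nat).
  split; [lra|]. split; [|lra].
  replace 2%R with (1 + 1)%R by ring. now apply Cmod_opp_plus_le.
- intros n. rewrite <- (plus_block_sum q n (S n)) by (assumption || lia).
  apply csum_ext. intros m _. unfold plus_block. ring.
- apply cser_ext with (2 := HL'). intros n.
  replace (n + S n)%nat with (S (2 * n)) by lia.
  replace (tri n + 0 * n + S n * n)%nat with (tri (S n) + n * n)%nat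
    by (simpl; lia).
  rewrite Cpow_add_r. unfold Cdiv. ring.
Qed.

Theorem proposition7p1 :
  forall q : C, (0 < Cmod q < 1)%R ->
    (ex_sum2 (F1_term q) /\ ex_sum2 (F2_term q) /\ ex_sum2 (F3_term q) /\
     @ex_series C_AbsRing C_NormedModule (fun k => Theta_plus_term q (S k)) /\
     @ex_series C_AbsRing C_NormedModule (fun k => Theta_minus_term q (S k)) /\
     (exists P : C, is_qpoch_inf q P) /\ qpoch_inf q <> 0) /\
    F1 q = Theta_minus q / qpoch_inf q /\
    F2 q = (/ q * (Theta_plus q - 1)) / qpoch_inf q /\
    F3 q = (/ q ^ 2 * (Theta_minus q - Theta_plus q)) / qpoch_inf q.
Proof.
intros q Hq.
assert (Hq0 : q <> 0) by now apply Cmod_gt_0.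
assert (Hq1 := proj2 Hq).
destruct (qpoch_cv q Hq1) as [P [HP HP0]].
destruct (qpoch_inf_unique q P HP) as [HPinf EP].
destruct (nahm_sum q P 0 0 (F1_term q) Hq HP HP0) as [l1 [H1 S1]].
{ intros n m. unfold F1_term.
  now replace (2 * n * m + 1 * n + 1 * m)%nat with (2 * n * m + n + m)%nat by ring. }
destruct (nahm_sum q P 0 1 (F2_term q) Hq HP HP0) as [l2 [H2 S2]].
{ intros n m. unfold F2_term.
  now replace (2 * n * m + 1 * n + 2 * m)%nat with (2 * n * m + n + 2 * m)%nat by ring. }
destruct (nahm_sum q P 1 1 (F3_term q) Hq HP HP0) as [l3 [H3 S3]].
{ reflexivity. }
assert (Tm : cser (fun k => Theta_minus_term q (S k)) (l1 * P)).
{ apply false_theta_minus; [exact Hq|]. apply cser_ext with (2 := S1).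
  intros n. now rewrite Nat.mul_1_l, Nat.add_0_r. }
assert (Tp : cser (fun k => Theta_plus_term q (S k)) (1 + q * (l2 * P))).
{ apply false_theta_plus; [exact Hq|]. apply cser_ext with (2 := S2).
  intros n. now rewrite Nat.mul_1_l. }
(* [(q)_{2n+2} / (q)_{n+1} = (1 + q^{n+1}) (q)_{2n+1} / (q)_n] *)
assert (E3 : l1 * P = 1 + (q * (l2 * P) + q ^ 2 * (l3 * P))).
{ apply cser_unique with (1 := S1).
  replace (RtoC 1) with (q ^ (1 * 0) * (qpoch q (2 * 0 + 0) / qpoch q 0))
    by (simpl; field).
  apply (cser_shift (fun n => q ^ (1 * n) * (qpoch q (2 * n + 0) / qpoch q n))).
  apply (cser_scal q) in S2. apply (cser_scal (q ^ 2)) in S3.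
  apply cser_ext with (2 := cser_plus _ _ _ _ S2 S3). intros n.
  replace (2 * S n + 0)%nat with (S (2 * n + 1)) by lia.
  change (qpoch q (S (2 * n + 1)))
    with (qpoch q (2 * n + 1) * (1 - q ^ S (2 * n + 1))).
  change (qpoch q (S n)) with (qpoch q n * (1 - q ^ S n)).
  replace (S (2 * n + 1)) with (S n + S n)%nat by lia.
  replace (2 * n)%nat with (n + n)%nat by lia. rewrite !Nat.mul_1_l.
  pose proof (qpoch_neq0 q n Hq1). pose proof (one_minus_pow_neq0 q n Hq1).
  rewrite !Cpow_add_r, !Cpow_S in *. field. split; assumption. }
unfold F1, F2, F3, Theta_plus, Theta_minus.
rewrite EP, (Sum2_unique _ _ H1), (Sum2_unique _ _ H2), (Sum2_unique _ _ H3),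
  (CSeries_unique _ _ Tp), (CSeries_unique _ _ Tm).
repeat split; try (now eexists; eassumption).
- exists (1 + q * (l2 * P)). now apply is_series_cser.
- exists (l1 * P). now apply is_series_cser.
- exact HP0.
- field. exact HP0.
- field. split; assumption.
- rewrite E3. field. split; assumption.
Qed.
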